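(* Fix $n\ge2$. Let $\Omega\subset\partial_\infty\mathbb H^n\times\mathbb R$ be a bounded $C^0$ domain with boundary $\Gamma=\partial\Omega$, and assume that $\Omega$ is convex. Let $f\in C^0(\Gamma)$ be a positive function, let $\epsilon\in[0,1]$, and let $g\in C^2(\Omega)\cap C^0(\overline\Omega)$ be a positive solution of the $\epsilon$-horizontal minimal equation $\mathcal M_\epsilon(g)=0$ in $\Omega$ such that $g=f$ on $\Gamma$. Then, given $\eta>0$, there is $\delta>0$ such that if $p\in\partial\Omega$ and $q\in\Omega$ satisfy $|q-p|<\delta$, then $|g(q)-g(p)|<\eta$, where $\delta$ depends only on $\eta$, $\delta_0$, $\min_\Gamma g$, $\max_\Gamma g$, $r(\Omega)$, $\max_\Omega|D\varphi^\pm|$ and $\max_\Omega|D^2\varphi^\pm|$, with $\delta_0$ and $\varphi^\pm$ as defined in the context (in particular, $\delta$ does not depend on $\epsilon$).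
   Context: Upper half-space model: $\mathbb H^n=\{(x_1,\dots,x_{n-1},y): y>0\}$, and $\partial_\infty\mathbb H^n\times\mathbb R$ is identified with $\mathbb R^{n-1}\times\mathbb R=\mathbb R^n$ with coordinates $(x_1,\dots,x_{n-1},t)$ and the Euclidean metric. For a positive $C^2$ function $g=g(x_1,\dots,x_{n-1},t)$ and $\epsilon\in[0,1]$ set $$\mathcal M_\epsilon(g)=\sum_{k=1}^{n-1}\Big[g^2\Big(1+\sum_{j\ne k,\,1\le j\le n-1}g_{x_j}^2\Big)+g_t^2+\tfrac{\epsilon}{n-1}\Big]g_{x_kx_k}+\Big(1+\sum_{k=1}^{n-1}g_{x_k}^2\Big)g_{tt}-2\sum_{k=1}^{n-1}g_{x_k}g_tg_{x_kt}-2g^2\sum_{1\le j<k\le n-1}g_{x_j}g_{x_k}g_{x_jx_k}+(n-1)g\Big(1+\sum_{k=1}^{n-1}g_{x_k}^2\Big)+(n-2)\frac{g_t^2}{g}.$$ The equation $\mathcal M_\epsilon(g)=0$ is the $\epsilon$-horizontal minimal equation. A $C^0$ domain $\Omega$ is convex if for every $p\in\partial\Omega$ there is an affine $(n-1)$-plane $\Pi$ of $\mathbb R^n$ with $p\in\Pi\cap\partial\Omega$, $\Pi\cap\Omega=\emptyset$ and $\Omega$ lying on one side of $\Pi$. Definition of $r(\Omega)$ and $R(\Omega,f)$: if $n\ge3$, let $\Omega^\pi$ be the orthogonal projection of $\Omega$ on the hyperplane $t=0$ (i.e. on $\mathbb R^{n-1}$); $r(\Omega)$ is the radius of the smallest closed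 round $(n-1)$-disk containing $\Omega^\pi$ with center in $\Omega^\pi$. If $n=2$ (coordinates $(x,t)$), $r(\Omega)=\tfrac12(\max_\Gamma x-\min_\Gamma x)$. In both cases $R(\Omega,f)=\sqrt{\max_\Gamma f^2+r^2(\Omega)}$. Given $\eta>0$, $\delta_0=\delta_0(f,\eta)>0$ denotes a constant such that $|f(p')-f(p)|<\eta/3$ whenever $p,p'\in\Gamma$ and $|p'-p|<\delta_0$. For $p\in\Gamma$, $$\varphi^\pm(q)=f(p)\pm\frac{\eta}{3}\pm R(\Omega,f)\,\frac{\ln(1+|q-p|^2)}{\ln(1+\delta_0^2)},\qquad q\in\Omega.$$ The quantities $\max_\Omega|D\varphi^\pm|$, $\max_\Omega|D^2\varphi^\pm|$ are understood as bounds that are uniform in $p\in\Gamma$. *)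

(* Defs.v *)
From mathcomp Require Import all_boot all_order all_algebra.
From mathcomp Require Import all_classical all_reals all_analysis.

Set Implicit Arguments.
Unset Strict Implicit.
Unset Printing Implicit Defensive.

Import Order.TTheory GRing.Theory Num.Theory.
Import numFieldNormedType.Exports.

Local Open Scope classical_set_scope.
Local Open Scope ring_scope.

(* R^n as R^(n-1) x R, meaningful for n >= 1: q.1 is (x_1, ..., x_(n-1)) and
   q.2 is t.  The library norm on this product is a sup norm, so the Euclidean
   structure is spelled out below; the topology is the usual one. *)
Notation pt R n := ('rV[R]_n.-1 * R)%type.

Section Euclidean.
Context {R : realType}.

Definition xnorm {m : nat} (x : 'rV[R]_m) : R :=
  Num.sqrt (\sum_(k < m) x 0 k ^+ 2).

Context {n : nat}.
Implicit Types p q : pt R n.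

Definition dotp p q : R := \sum_(k < n.-1) p.1 0 k * q.1 0 k + p.2 * q.2.

Definition enorm p : R := Num.sqrt (dotp p p).

(* The standard basis of R^n: [Some k] is the x_k direction, [None] is the
   t direction. *)
Definition axis (i : option 'I_n.-1) : pt R n :=
  if i is Some k then (delta_mx 0 k, 0) else (0, 1).

Definition pd (g : pt R n -> R) (i : option 'I_n.-1) : pt R n -> R :=
  fun q => 'D_(axis i) g q.

(* First along i, then along j: the partial derivative g_{ij}. *)
Definition pd2 (g : pt R n -> R) (i j : option 'I_n.-1) : pt R n -> R :=
  pd (pd g i) j.

Definition grad_norm (g : pt R n -> R) q : R :=
  Num.sqrt (\sum_i pd g i q ^+ 2).

(* Frobenius norm of the Hessian. *)
Definition hess_norm (g : pt R n -> R) q : R :=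
  Num.sqrt (\sum_i \sum_j pd2 g i j q ^+ 2).

(* Meant for open sets Omega. *)
Definition C2_on (Omega : set (pt R n)) (g : pt R n -> R) : Prop :=
  forall q, Omega q ->
    {for q, continuous g} /\
    (forall i, derivable g q (axis i) /\ {for q, continuous (pd g i)}) /\
    (forall i j, derivable (pd g i) q (axis j) /\ {for q, continuous (pd2 g i j)}).

Definition bdry (Omega : set (pt R n)) : set (pt R n) :=
  closure Omega `\` interior Omega.

(* Near each boundary point p, Omega is the set of points lying strictly above
   the graph of a continuous function h over the hyperplane orthogonal to some
   unit vector u, heights being measured along u. *)
Definition C0_boundary (Omega : set (pt R n)) : Prop :=
  forall p, bdry Omega p ->
    exists u : pt R n, exists h : pt R n -> R,
      [/\ enorm u = 1, continuous h &
        \forall q \near p,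
          Omega q <-> h (q - dotp q u *: u) < dotp q u].

Definition C0_domain (Omega : set (pt R n)) : Prop :=
  [/\ Omega !=set0, open Omega, connected Omega & C0_boundary Omega].

Definition hyperplane (nu : pt R n) (c : R) : set (pt R n) :=
  [set q | dotp nu q = c].

Definition on_one_side (Omega : set (pt R n)) (nu : pt R n) (c : R) : Prop :=
  (forall q, Omega q -> dotp nu q <= c) \/ (forall q, Omega q -> c <= dotp nu q).

Definition convex_domain (Omega : set (pt R n)) : Prop :=
  forall p, bdry Omega p ->
    exists nu : pt R n, exists c : R,
      [/\ nu != 0, (hyperplane nu c `&` bdry Omega) p,
          hyperplane nu c `&` Omega = set0 & on_one_side Omega nu c].

Definition Meps (eps : R) (g : pt R n -> R) q : R :=
  let gq := g q in
  let gx k := pd g (Some k) q in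
  let gt := pd g None q in
  let gxx j k := pd2 g (Some j) (Some k) q in
  let gxt k := pd2 g (Some k) None q in
  let gtt := pd2 g None None q in
  \sum_(k < n.-1)
     (gq ^+ 2 * (1 + \sum_(j < n.-1 | j != k) gx j ^+ 2)
       + gt ^+ 2 + eps / n.-1%:R) * gxx k k
  + (1 + \sum_(k < n.-1) gx k ^+ 2) * gtt
  - 2 * \sum_(k < n.-1) gx k * gt * gxt k
  - 2 * gq ^+ 2 *
      \sum_(k < n.-1) \sum_(j < n.-1 | (j < k)%N) gx j * gx k * gxx j k
  + n.-1%:R * gq * (1 + \sum_(k < n.-1) gx k ^+ 2)
  + n.-2%:R * (gt ^+ 2 / gq).

End Euclidean.

(* For n = 2, half the x-width of the boundary.  Otherwise, the infimum of the
   radii of the closed round disks of R^(n-1) that contain the projection of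
   Omega and are centered in it; since the projection is open, the infimum
   need not be attained by a center in the projection itself. *)
Definition r_dom (R : realType) (n : nat) : set (pt R n) -> R :=
  match n return set (pt R n) -> R with
  | 2 => fun Omega =>
      (sup [set q.1 0 0 | q in bdry Omega]
        - inf [set q.1 0 0 | q in bdry Omega]) / 2
  | _ => fun Omega =>
      inf [set rho : R | 0 <= rho /\
             exists2 c, (fst @` Omega) c &
               forall x, (fst @` Omega) x -> xnorm (x - c) <= rho]
  end.

Section Barriers.
Context {R : realType} {n : nat}.
Implicit Types (Omega : set (pt R n)) (f : pt R n -> R) (p q : pt R n).

Definition R_dom Omega f : R :=
  Num.sqrt (sup [set f p ^+ 2 | p in bdry Omega] + r_dom Omega ^+ 2).

Definition is_delta0 Omega f (eta delta0 : R) : Prop :=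
  0 < delta0 /\
  forall p p', bdry Omega p -> bdry Omega p' -> enorm (p' - p) < delta0 ->
    `|f p' - f p| < eta / 3.

(* [barrier false] is phi^+ and [barrier true] is phi^-. *)
Definition barrier (s : bool) Omega f (eta delta0 : R) p q : R :=
  f p + (-1) ^+ s * (eta / 3)
  + (-1) ^+ s * (R_dom Omega f * (ln (1 + enorm (q - p) ^+ 2)
                                 / ln (1 + delta0 ^+ 2))).

(* B1 and B2 bound |D phi^+-| and |D^2 phi^+-| on Omega, uniformly in the base
   point p of the barriers. *)
Definition barrier_bounds Omega f (eta delta0 B1 B2 : R) : Prop :=
  forall (s : bool) p q, bdry Omega p -> Omega q ->
    grad_norm (barrier s Omega f eta delta0 p) q <= B1 /\
    hess_norm (barrier s Omega f eta delta0 p) q <= B2.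

End Barriers.

(* Main.v *)
(** Elliptic form: with P = Dg, the second-order part of M_eps(g) is a
    nonnegative combination of second derivatives of g along the vectors e_k,
    p_k e_j - p_j e_k, p_t e_k - p_k e_t and e_t.  At an interior minimum of g
    the remaining term (n-1) g is positive, so g >= min f.  At an interior maximum of
    g + |x - c|^2 / 2 the equation forces g <= 1 + |x - c|^2, which bounds g
    above in terms of max f and r(Omega).

    For the modulus at p, with inward unit normal nu of a supporting
    hyperplane, +-(g - g(p)) is compared with
      eta/3 + A |q - p|^2 + ln(1 + beta nu.(q - p)) / K.
    At an interior contact point Dg = v + z, where v comes from the quadratic
    term and is bounded, and z = psi nu is as steep as desired; the logarithm
    contributes -K times the elliptic form evaluated at z, which is at least
    min(mu^2, 1) psi^2 because the form is at least min(g^2, 1)|z|^2, whatever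
    P is.  This beats every other term, all of which are O(1 + |P|^2), once K
    and then beta are large.  The quadratic term replaces the logarithmic one
    of phi^+-. *)

Require Import Defs.
From mathcomp Require Import all_boot all_order all_algebra.
From mathcomp Require Import all_classical all_reals all_analysis.
From mathcomp Require Import ring lra.

Import Order.TTheory GRing.Theory Num.Theory.
Import numFieldNormedType.Exports.

Local Open Scope classical_set_scope.
Local Open Scope ring_scope.

(* [phi h = phi 0 + c1 h + c2 h^2 / 2 + o(h^2)] as h tends to 0. *)
Definition jet2 {R : realType} (phi : R -> R) (c1 c2 : R) : Prop :=
  forall e : R, 0 < e -> exists2 rho : R, 0 < rho &
    forall h, `|h| < rho ->
      `|phi h - phi 0 - c1 * h - c2 * (h ^+ 2 / 2)| <= e * h ^+ 2.

(** * Second-order expansions of functions of one real variable *)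

Section Jets.
Context {R : realType}.
Implicit Types phi psi : R -> R.

Lemma MVT_abs (phi dphi : R -> R) (M h : R) :
  (forall x : R, `|x| <= `|h| -> is_derive x 1 phi (dphi x)) ->
  (forall x : R, `|x| <= `|h| -> `|dphi x| <= M) ->
  `|phi h - phi 0| <= M * `|h|.
Proof.
move=> Dphi leM.
have cphi x : `|x| <= `|h| -> {for x, continuous phi}.
  move=> /Dphi Dx; apply: differentiable_continuous.
  by apply/derivable1_diffP; apply: ex_derive.
have [h0|h0] := leP 0 h.
- have le0h x : x \in `[0, h] -> `|x| <= `|h|.
    by rewrite in_itv /= => /andP[x0 xh]; rewrite !ger0_norm.
  have [||c ch ->] := @MVT_segment R phi dphi 0 h h0.
  + by move=> x xh; apply/Dphi/le0h; apply: subset_itv_oo_cc.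
  + apply: continuous_in_subspaceT => x; rewrite inE /= => xh.
    exact/cphi/le0h.
  + by rewrite subr0 normrM ler_wpM2r//; apply/leM/le0h.
- have le0h x : x \in `[h, 0] -> `|x| <= `|h|.
    by rewrite in_itv /= => /andP[xh x0]; rewrite !ler0_norm ?lerN2 // ltW.
  have [||c ch E] := @MVT_segment R phi dphi h 0 (ltW h0).
  + by move=> x xh; apply/Dphi/le0h; apply: subset_itv_oo_cc.
  + apply: continuous_in_subspaceT => x; rewrite inE /= => xh.
    exact/cphi/le0h.
  + by rewrite distrC E sub0r normrM normrN ler_wpM2r//; apply/leM/le0h.
Qed.

Lemma taylor1_le (phi dphi : R -> R) (c e h : R) :
  (forall x : R, `|x| <= `|h| -> is_derive x 1 phi (dphi x)) ->
  (forall x : R, `|x| <= `|h| -> `|dphi x - c| <= e) ->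
  `|phi h - phi 0 - c * h| <= e * `|h|.
Proof.
move=> Dphi le_e.
pose psi x := phi x - c * x.
have := @MVT_abs psi (fun x => dphi x - c) e h.
rewrite /psi mulr0 subr0 addrAC; apply=> // x xh.
have := Dphi x xh => ?.
apply: is_derive_eq.
by rewrite /GRing.scale /= mulr1 ?mulr0 ?addr0.
Qed.

(** The first-order estimate for dphi bounds the derivative of phi(x) - dphi(0) x - c x^2 / 2 by e
    |h|; a second use of the mean value inequality turns this into e h^2. *)
Lemma taylor2_le (phi dphi ddphi : R -> R) (c e h : R) :
  (forall x : R, `|x| <= `|h| -> is_derive x 1 phi (dphi x)) ->
  (forall x : R, `|x| <= `|h| -> is_derive x 1 dphi (ddphi x)) ->
  (forall x : R, `|x| <= `|h| -> `|ddphi x - c| <= e) ->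
  `|phi h - phi 0 - dphi 0 * h - c * (h ^+ 2 / 2)| <= e * h ^+ 2.
Proof.
move=> Dphi Ddphi le_e.
have e0 : 0 <= e.
  have : `|0 : R| <= `|h| by rewrite normr0.
  by move/le_e; apply: le_trans; exact: normr_ge0.
have led x : `|x| <= `|h| -> `|dphi x - dphi 0 - c * x| <= e * `|h|.
  move=> xh; apply: (@le_trans _ _ (e * `|x|)); last exact: ler_wpM2l.
  apply: (@taylor1_le _ ddphi) => y yx; first exact/Ddphi/(le_trans yx).
  exact/le_e/(le_trans yx).
pose psi x := phi x - dphi 0 * x - c * (x ^+ 2 / 2).
have := @MVT_abs psi (fun x => dphi x - dphi 0 - c * x) (e * `|h|) h.
have -> : e * `|h| * `|h| = e * h ^+ 2 by rewrite -mulrA -expr2 real_normK ?num_real.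
have -> : psi h - psi 0 = phi h - phi 0 - dphi 0 * h - c * (h ^+ 2 / 2).
  by rewrite /psi; ring.
apply=> // x xh; have := Dphi x xh => ?.
apply: is_derive_eq.
by rewrite /GRing.scale /=; field.
Qed.

Lemma jet2_C2 (phi dphi ddphi : R -> R) (r : R) : 0 < r ->
  (forall x : R, `|x| < r -> is_derive x 1 phi (dphi x)) ->
  (forall x : R, `|x| < r -> is_derive x 1 dphi (ddphi x)) ->
  {for 0, continuous ddphi} -> jet2 phi (dphi 0) (ddphi 0).
Proof.
move=> r0 Dphi Ddphi cdd e e0.
have /cvgrPdist_le /(_ e e0) /nbhs_ballP [rho /= rho0 le_e] := cdd.
exists (Num.min r rho); first by rewrite lt_min r0.
move=> h; rewrite lt_min => /andP[hr hrho].
apply: (@taylor2_le phi dphi ddphi (ddphi 0) e h) => x xh; [exact/Dphi/(le_lt_trans xh)| |].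
  exact/Ddphi/(le_lt_trans xh).
rewrite distrC; apply: le_e.
by rewrite /ball /= sub0r normrN; exact: le_lt_trans hrho.
Qed.

Lemma jet2D phi psi c1 c2 d1 d2 : jet2 phi c1 c2 -> jet2 psi d1 d2 ->
  jet2 (fun h => phi h + psi h) (c1 + d1) (c2 + d2).
Proof.
move=> jp jq e e0.
have e2 : 0 < e / 2 by rewrite divr_gt0.
have [r1 r10 le1] := jp _ e2; have [r2 r20 le2] := jq _ e2.
exists (Num.min r1 r2); first by rewrite lt_min r10.
move=> h; rewrite lt_min => /andP[/le1 {}le1 /le2 {}le2].
have := lerD le1 le2; rewrite -mulrDl -splitr; apply: le_trans.
apply: le_trans (ler_normD _ _); rewrite le_eqVlt; apply/orP; left; apply/eqP.
congr (`|_|); ring.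
Qed.

Lemma jet2Z (k : R) phi c1 c2 : jet2 phi c1 c2 ->
  jet2 (fun h => k * phi h) (k * c1) (k * c2).
Proof.
move=> jp e e0.
have k0 : 0 < `|k| + 1 by apply: ltr_wpDl.
have [r r0 le1] := jp _ (divr_gt0 e0 k0); exists r => // h /le1 {}le1.
have -> : k * phi h - k * phi 0 - k * c1 * h - k * c2 * (h ^+ 2 / 2)
  = k * (phi h - phi 0 - c1 * h - c2 * (h ^+ 2 / 2)) by ring.
rewrite normrM (le_trans (ler_wpM2l (normr_ge0 _) le1))//.
rewrite mulrA ler_wpM2r ?sqr_ge0// mulrCA; apply: ler_piMr; first exact: ltW.
by rewrite ler_pdivrMr// mul1r lerDl.
Qed.

Lemma jet2_quad (a b c : R) : jet2 (fun h => a + b * h + c * h ^+ 2) b (2 * c).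
Proof.
move=> e e0; exists 1 => // h _.
rewrite [X in `|X|](_ : _ = 0); last by field.
by rewrite normr0 mulr_ge0 ?sqr_ge0 // ltW.
Qed.

(** The usual tests at a maximum need only the expansion: it turns the local maximum into the
    inequality [key], which is then tried on one well-chosen h for each conclusion. *)
Lemma jet2_max phi c1 c2 : jet2 phi c1 c2 ->
  (exists2 rho : R, 0 < rho & forall h : R, `|h| < rho -> phi h <= phi 0) ->
  c1 = 0 /\ c2 <= 0.
Proof.
move=> jp [rho rho0 max0].
have key (e : R) : 0 < e -> exists2 r : R, 0 < r & forall h : R, `|h| < r ->
    c1 * h + c2 * (h ^+ 2 / 2) <= e * h ^+ 2.
  move=> e0; have [r r0 ler] := jp _ e0.
  exists (Num.min r rho); first by rewrite lt_min r0.
  move=> h; rewrite lt_min => /andP[/ler + /max0 hm].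
  rewrite ler_norml => /andP[h1 _]; lra.
have c10 : c1 = 0.
  have [r r0 ler] := key 1 ltr01.
  apply/eqP; apply: contraT => c1N0.
  (* [M] dominates the quadratic terms when [key] is used with e = 1. For the step h = sign(c1) t
     with M t <= |c1| / 2, the linear term |c1| t exceeds them. *)
  pose M := 1 + `|c2|.
  have M0 : 0 < M by rewrite ltr_pwDl.
  have M20 : 0 < 2 * M by rewrite mulr_gt0.
  have ac : 0 < `|c1| by rewrite normr_gt0.
  pose t := Num.min (r / 2) (`|c1| / (2 * M)).
  have t0 : 0 < t by rewrite lt_min !divr_gt0.
  have tr : t < r.
    by rewrite /t gt_min ltr_pdivrMr// ltr_pMr// ltr1n.
  have tM : M * t <= `|c1| / 2.
    rewrite (@le_trans _ _ (M * (`|c1| / (2 * M))))//.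
      by rewrite ler_wpM2l ?ge_min ?lexx ?orbT // ltW.
    by rewrite le_eqVlt; apply/orP; left; apply/eqP; field; rewrite gt_eqF.
  have := ler (Num.sg c1 * t).
  rewrite normrM normr_sg c1N0 /= !mul1r gtr0_norm// => /(_ tr).
  have -> : c1 * (Num.sg c1 * t) = `|c1| * t by rewrite mulrCA mulrA -normrEsg.
  rewrite exprMn sqr_sg c1N0 /= !mul1r.
  have c2n : - `|c2| <= c2 by rewrite lerNl -normrN ler_norm.
  have : M * t ^+ 2 <= `|c1| * t / 2.
    by have := ler_wpM2r (ltW t0) tM; rewrite -(mulrA M) -expr2 mulrAC.
  rewrite /M => H1 H2.
  have t2 : 0 < t ^+ 2 by rewrite exprn_gt0.
  have ct : 0 < `|c1| * t by rewrite mulr_gt0.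
  have c2t : - `|c2| * t ^+ 2 <= c2 * t ^+ 2 by rewrite ler_wpM2r // ltW.
  have c2t' : 0 <= `|c2| * t ^+ 2 by rewrite mulr_ge0 // ltW.
  lra.
split=> //; rewrite leNgt; apply/negP => c20.
(* With c1 = 0 this would give c2 h^2 / 2 <= c2 h^2 / 4 for small h. *)
have [r r0 ler] := key (c2 / 4) (divr_gt0 c20 (ltr0n _ 4)).
have r20 : 0 < r / 2 by rewrite divr_gt0.
have := ler (r / 2); rewrite c10 mul0r add0r gtr0_norm // ltr_pdivrMr// ltr_pMr// ltr1n.
move=> /(_ isT).
have : 0 < c2 * (r / 2) ^+ 2 by rewrite mulr_gt0 // exprn_gt0.
lra.
Qed.

End Jets.

(** * Expansions along lines in a normed space *)

Section LineJets.
Context {R : realType} {V : normedModType R}.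
Implicit Types (g : V -> R) (X Y e u v : V).

Lemma is_derive_line g (dg : V -> R) Y e (s : R) :
  is_derive (Y + s *: e) e g (dg (Y + s *: e)) ->
  is_derive s 1 (fun t : R => g (Y + t *: e)) (dg (Y + s *: e)).
Proof.
have E : (fun h : R => h^-1 *: (((fun t : R => g (Y + t *: e)) \o shift s) (h *: 1)
             - g (Y + s *: e)))
       = (fun h : R => h^-1 *: ((g \o shift (Y + s *: e)) (h *: e) - g (Y + s *: e))).
  apply/funext => h /=; congr (_ *: (g _ - _)).
  have -> : h *: (1 : R) = h by exact: mulr1.
  by rewrite scalerDl addrCA.
move=> [d1 d2]; split.
  by rewrite /derivable E.
by rewrite /derive E.
Qed.

(* The second-order increment along [a u + b v] is split at [X + h a u], so only
   the mixed derivative "v first, then u" is involved and symmetry of second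
   derivatives is not needed. *)
Lemma jet2_plane (Omega : set V) (g gu gv guu gvu gvv : V -> R) X u v (a b : R) :
  nbhs X Omega ->
  (forall Y, Omega Y -> is_derive Y u g (gu Y)) ->
  (forall Y, Omega Y -> is_derive Y v g (gv Y)) ->
  (forall Y, Omega Y -> is_derive Y u gu (guu Y)) ->
  (forall Y, Omega Y -> is_derive Y u gv (gvu Y)) ->
  (forall Y, Omega Y -> is_derive Y v gv (gvv Y)) ->
  {for X, continuous guu} -> {for X, continuous gvu} -> {for X, continuous gvv} ->
  jet2 (fun h : R => g (X + h *: (a *: u + b *: v)))
    (a * gu X + b * gv X)
    (a ^+ 2 * guu X + 2 * a * b * gvu X + b ^+ 2 * gvv X).
Proof.
move=> OX Dgu Dgv Dguu Dgvu Dgvv cuu cvu cvv e e0.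
(* The three error terms below add up to e' ((h b)^2 + h^2 |a b| + (h a)^2), which is at most e' M
   h^2 = e h^2. *)
pose M := a ^+ 2 + `|a * b| + b ^+ 2 + 1.
have M0 : 0 < M.
  by rewrite ltr_wpDl// !addr_ge0 ?sqr_ge0.
pose e' := e / M.
have e'0 : 0 < e' by rewrite divr_gt0.
have /nbhs_ballP [r /= r0 Nr] : nbhs X [set Y | [/\ Omega Y,
    `|guu Y - guu X| <= e', `|gvu Y - gvu X| <= e' & `|gvv Y - gvv X| <= e']].
  move/cvgrPdist_le : cuu => /(_ _ e'0) cuu.
  move/cvgrPdist_le : cvu => /(_ _ e'0) cvu.
  move/cvgrPdist_le : cvv => /(_ _ e'0) cvv.
  near=> Y; split; [by near: Y| | |]; rewrite distrC; near: Y; assumption.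
pose S := `|a| * `|u| + `|b| * `|v| + 1.
have S0 : 0 < S by rewrite ltr_wpDl// addr_ge0// mulr_ge0.
exists (r / S); first by rewrite divr_gt0.
move=> h hr.
have inB s t : `|s| <= `|h * a| -> `|t| <= `|h * b| -> ball X r (X + s *: u + t *: v).
  move=> sh th; rewrite -ball_normE /ball_ /= opprD opprD addrA addrA subrr sub0r.
  rewrite -opprD normrN; apply: le_lt_trans (ler_normD _ _) _; rewrite !normrZ.
  apply: (@le_lt_trans _ _ (`|h| * S)); last by rewrite -ltr_pdivlMr.
  have h1 : `|s| * `|u| <= `|h| * (`|a| * `|u|).
    by rewrite mulrA -normrM ler_wpM2r.
  have h2 : `|t| * `|v| <= `|h| * (`|b| * `|v|).
    by rewrite mulrA -normrM ler_wpM2r.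
  rewrite /S !mulrDr mulr1; have := normr_ge0 h; lra.
have n0 (x : R) : `|0 : R| <= `|x| by rewrite normr0.
have inBu s : `|s| <= `|h * a| -> ball X r (X + s *: u).
  by move=> sh; have := inB s 0 sh (n0 _); rewrite scale0r addr0.
(* Corner of the path that leaves X along u and then continues along v. [T3] and [T1] expand g on
   the two legs, and [T2] carries the slope along v from Y back to X. *)
pose Y := X + (h * a) *: u.
have inBv t : `|t| <= `|h * b| -> ball X r (Y + t *: v).
  by move=> th; exact: inB.
have T1 := @taylor2_le R (fun t => g (Y + t *: v)) (fun t => gv (Y + t *: v))
  (fun t => gvv (Y + t *: v)) (gvv X) e' (h * b).
have T2 := @taylor1_le R (fun s => gv (X + s *: u)) (fun s => gvu (X + s *: u))
  (gvu X) e' (h * a).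
have T3 := @taylor2_le R (fun s => g (X + s *: u)) (fun s => gu (X + s *: u))
  (fun s => guu (X + s *: u)) (guu X) e' (h * a).
have {}T1 : `|g (Y + (h * b) *: v) - g Y - gv Y * (h * b) - gvv X * ((h * b) ^+ 2 / 2)|
   <= e' * (h * b) ^+ 2.
  move: T1; rewrite scale0r addr0; apply=> t /inBv/Nr[OY *] //.
    by apply: is_derive_line; apply: Dgv.
  by apply: is_derive_line; apply: Dgvv.
have {}T2 : `|gv Y - gv X - gvu X * (h * a)| <= e' * `|h * a|.
  move: T2; rewrite scale0r addr0; apply=> s /inBu/Nr[OY *] //.
  by apply: is_derive_line; apply: Dgvu.
have {}T3 : `|g Y - g X - gu X * (h * a) - guu X * ((h * a) ^+ 2 / 2)|
   <= e' * (h * a) ^+ 2.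
  move: T3; rewrite scale0r addr0; apply=> s /inBu/Nr[OY *] //.
    by apply: is_derive_line; apply: Dgu.
  by apply: is_derive_line; apply: Dguu.
rewrite scale0r addr0.
have -> : X + h *: (a *: u + b *: v) = Y + (h * b) *: v.
  by rewrite /Y scalerDr !scalerA addrA.
clear -T1 T2 T3 M0 e'0.
move: (g _) (g Y) (g X) (gu X) (gv Y) (gv X) (guu X) (gvu X) (gvv X) T1 T2 T3.
move=> g2 g1 g0 u0 v1 v0 uu vu vv T1 T2 T3.
have {}T2 : `|(v1 - v0 - vu * (h * a)) * (h * b)| <= e' * (h ^+ 2 * `|a * b|).
  rewrite normrM (le_trans (ler_wpM2r (normr_ge0 _) T2))// -mulrA -normrM.
  have -> : h * a * (h * b) = h ^+ 2 * (a * b) by ring.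
  by rewrite normrM (ger0_norm (sqr_ge0 h)).
have eM : e = e' * M by rewrite /e' divfK // gt_eqF.
have : `|(g2 - g1 - v1 * (h * b) - vv * ((h * b) ^+ 2 / 2))
   + (v1 - v0 - vu * (h * a)) * (h * b)
   + (g1 - g0 - u0 * (h * a) - uu * ((h * a) ^+ 2 / 2))|
   <= e' * (h * b) ^+ 2 + e' * (h ^+ 2 * `|a * b|) + e' * (h * a) ^+ 2.
  apply: (le_trans (ler_normD _ _)); rewrite lerD//.
  by apply: (le_trans (ler_normD _ _)); rewrite lerD.
have -> : (g2 - g1 - v1 * (h * b) - vv * ((h * b) ^+ 2 / 2))
   + (v1 - v0 - vu * (h * a)) * (h * b)
   + (g1 - g0 - u0 * (h * a) - uu * ((h * a) ^+ 2 / 2))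
  = g2 - g0 - (a * u0 + b * v0) * h
    - (a ^+ 2 * uu + 2 * a * b * vu + b ^+ 2 * vv) * (h ^+ 2 / 2) by field.
move=> /le_trans; apply; rewrite eM /M.
have : 0 <= e' * h ^+ 2 by rewrite mulr_ge0 ?sqr_ge0// ltW.
have := normr_ge0 (a * b); move: (`|a * b|) => c; clearbody e'.
clear -e'0 => c0 Q0; lra.
Unshelve. all: by end_near.
Qed.

End LineJets.

(** The quadratic form of the Hessian on a e_i + b e_j. The mixed derivative is taken along e_j
    first, as delivered by [jet2_plane]; [ell] chooses i and j so that this is also the order in
    [Meps]. *)
Definition hess2 {R : realType} {n : nat} (g : pt R n -> R) X i j (a b : R) : R :=
  a ^+ 2 * pd2 g i i X + 2 * a * b * pd2 g j i X + b ^+ 2 * pd2 g j j X.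

(** * First- and second-order conditions at a contact point *)

Section Touching.
Context {R : realType} {n : nat}.
Variables (Omega : set (pt R n)) (g : pt R n -> R).
Hypotheses (oO : open Omega) (C2g : C2_on Omega g).

Lemma jet2_C2_on X i j (a b : R) : Omega X ->
  jet2 (fun h : R => g (X + h *: (a *: axis i + b *: axis j)))
    (a * pd g i X + b * pd g j X) (hess2 g X i j a b).
Proof.
move=> OX.
have Dg Y k : Omega Y -> is_derive Y (axis k) g (pd g k Y).
  move=> /C2g[_ [+ _]] => /(_ k)[d _]; exact: (DeriveDef d erefl).
have DDg Y k l : Omega Y -> is_derive Y (axis l) (pd g k) (pd2 g k l Y).
  move=> /C2g[_ [_ +]] => /(_ k l)[d _]; exact: (DeriveDef d erefl).
have cDDg k l : {for X, continuous (pd2 g k l)}.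
  by case: (C2g X OX) => [_ [_ /(_ k l)[_ ]]].
apply: (@jet2_plane R _ Omega g _ _ _ _ _ X _ _ a b); try by move=> Y; auto.
- by move/open_nbhs_nbhs : (conj oO OX).
- exact: cDDg.
- exact: cDDg.
- exact: cDDg.
Qed.

(** Taking s = 1 or s = -1 treats test functions touching g from above and from below at once. On
    the given line through X the function s g - W has a local maximum at X, so [jet2_max] applies; W
    enters only through its expansion on that line. *)
Lemma touching (s : R) (W : pt R n -> R) X i j (a b w1 w2 : R) : Omega X ->
  (forall Y, Omega Y -> s * g Y - W Y <= s * g X - W X) ->
  jet2 (fun h : R => W (X + h *: (a *: axis i + b *: axis j))) w1 w2 ->
  s * (a * pd g i X + b * pd g j X) = w1 /\ s * hess2 g X i j a b <= w2.
Proof.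
move=> OX max jW; have jg := @jet2_C2_on X i j a b OX.
have := jet2_max _ _ _ (jet2D _ _ _ _ _ _ (jet2Z s _ _ _ jg) (jet2Z (-1) _ _ _ jW)).
rewrite !mulN1r scale0r addr0 => -[|/eqP + le0].
  have /nbhs_ballP [r /= r0 Nr] := open_nbhs_nbhs (conj oO OX).
  set e := a *: _ + _.
  have S0 : 0 < `|e| + 1 by rewrite ltr_wpDl.
  exists (r / (`|e| + 1)); first by rewrite divr_gt0.
  move=> h hr; rewrite mulN1r; apply: max; apply: Nr.
  rewrite -ball_normE /ball_ /= opprD addrA subrr sub0r normrN normrZ.
  rewrite ltr_pdivlMr// in hr; apply: le_lt_trans hr.
  by rewrite ler_wpM2l// lerDl.
by rewrite subr_eq0 => /eqP ->; split=> //; rewrite -subr_le0.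
Qed.

End Touching.

(** * Algebra of the principal part *)

Section Elliptic.
Context {R : realType} {m : nat}.
Implicit Types (P z v : option 'I_m -> R) (E : option 'I_m -> option 'I_m -> R -> R -> R).

Definition sqn z : R := \sum_(k < m) z (Some k) ^+ 2 + z None ^+ 2.

(* The principal part of the operator at height [u] and gradient [P], written as
   a nonnegative combination of values [E i j a b] of the Hessian form on vectors
   [a e_i + b e_j]. *)
Definition ell (u e' : R) P E : R :=
  \sum_(k < m) (u ^+ 2 + e') * E (Some k) (Some k) 1 0
  + u ^+ 2 * (\sum_(k < m) \sum_(j < m | (j < k)%N)
       E (Some k) (Some j) (- P (Some j)) (P (Some k)))
  + \sum_(k < m) E None (Some k) (- P (Some k)) (P None)
  + E None None 1 0.

(** Groups (j, k) with (k, j), so that the ordered pairs in the diagonal coefficients match the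
    pairs j < k of the cross terms. *)
Lemma sum_neq_lt (F : 'I_m -> 'I_m -> R) :
  \sum_(k < m) \sum_(j < m | j != k) F j k
  = \sum_(k < m) \sum_(j < m | (j < k)%N) (F j k + F k j).
Proof.
transitivity (\sum_(k < m) (\sum_(j < m | (j < k)%N) F j k
    + \sum_(j < m | (k < j)%N) F j k)).
  apply: eq_bigr => k _; rewrite (bigID (fun j : 'I_m => (j < k)%N)) /=.
  congr (_ + _); apply: eq_bigl => j; rewrite -val_eqE /=; case: ltngtP => //.
rewrite big_split /= [X in _ + X](exchange_big_dep predT) //= -big_split /=.
by apply: eq_bigr => k _; rewrite big_split.
Qed.

Lemma ler_ell (u e' s : R) P E E1 : 0 <= e' ->
  (forall i j a b, s * E i j a b <= E1 i j a b) ->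
  s * ell u e' P E <= ell u e' P E1.
Proof.
move=> e'0 leE; rewrite /ell 3!(mulrDr s).
have u2 : 0 <= u ^+ 2 by exact: sqr_ge0.
apply: lerD => //; apply: lerD; last by rewrite mulr_sumr; apply: ler_sum.
apply: lerD.
  rewrite mulr_sumr; apply: ler_sum => k _.
  by rewrite mulrCA ler_wpM2l // addr_ge0.
rewrite mulrCA ler_wpM2l // mulr_sumr; apply: ler_sum => k _.
by rewrite mulr_sumr; apply: ler_sum.
Qed.

Lemma ell_combo (u e' c d : R) P E E1 :
  ell u e' P (fun i j a b => c * E i j a b - d * E1 i j a b)
  = c * ell u e' P E - d * ell u e' P E1.
Proof.
rewrite /ell.
set a1 := \sum_(k < m) (_ + _) * E _ _ _ _; set b1 := \sum_(k < m) (_ + _) * E1 _ _ _ _.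
set a3 := \sum_(k < m) E _ _ _ _; set b3 := \sum_(k < m) E1 _ _ _ _.
set a2 := \sum_(k < m) \sum_(j < m | _) E _ _ _ _.
set b2 := \sum_(k < m) \sum_(j < m | _) E1 _ _ _ _.
have -> : \sum_(k < m) (u ^+ 2 + e') *
   (c * E (Some k) (Some k) 1 0 - d * E1 (Some k) (Some k) 1 0) = c * a1 - d * b1.
  rewrite !mulr_sumr -sumrB; apply: eq_bigr => k _; ring.
have -> : \sum_(k < m) \sum_(j < m | (j < k)%N)
   (c * E (Some k) (Some j) (- P (Some j)) (P (Some k)) -
    d * E1 (Some k) (Some j) (- P (Some j)) (P (Some k))) = c * a2 - d * b2.
  rewrite !mulr_sumr -sumrB; apply: eq_bigr => k _.
  by rewrite !mulr_sumr -sumrB.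
have -> : \sum_(k < m) (c * E None (Some k) (- P (Some k)) (P None) -
   d * E1 None (Some k) (- P (Some k)) (P None)) = c * a3 - d * b3.
  by rewrite !mulr_sumr -sumrB.
ring.
Qed.

(** The vectors in the (x_j, x_k) planes contribute the sum of P_j^2 over j != k, at most m times
    the sum of all P_j^2; the other vectors are counted directly. The growth is quadratic in P,
    which the steep part of the barrier can match. *)
Lemma ell_norm_le (u e' G : R) P : 0 <= e' <= 1 -> 0 <= u <= G ->
  ell u e' P (fun _ _ a b => a ^+ 2 + b ^+ 2)
  <= (m%:R * (G ^+ 2 + 1) + m%:R + 1) * (1 + sqn P).
Proof.
move=> /andP[e0 e1] /andP[u0 uG].
pose p := \sum_(k < m) P (Some k) ^+ 2.
have p0 : 0 <= p by apply: sumr_ge0 => k _; apply: sqr_ge0.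
pose t := P None ^+ 2; have t0 : 0 <= t by apply: sqr_ge0.
have uG2 : u ^+ 2 <= G ^+ 2 by rewrite ler_sqr ?nnegrE // (le_trans u0).
have m0 : 0 <= m%:R :> R by [].
rewrite /ell.
have -> : \sum_(k < m) (u ^+ 2 + e') * (1 ^+ 2 + 0 ^+ 2) = m%:R * (u ^+ 2 + e').
  by rewrite expr1n expr0n addr0 mulr1 sumr_const card_ord mulr_natl.
have -> : \sum_(k < m) ((- P (Some k)) ^+ 2 + P None ^+ 2) = p + m%:R * t.
  rewrite big_split /= sumr_const card_ord mulr_natl; congr (_ + _).
  by apply: eq_bigr => k _; rewrite sqrrN.
have -> : \sum_(k < m) \sum_(j < m | (j < k)%N)
    ((- P (Some j)) ^+ 2 + P (Some k) ^+ 2)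
  = \sum_(k < m) \sum_(j < m | j != k) P (Some j) ^+ 2.
  rewrite sum_neq_lt; apply: eq_bigr => k _; apply: eq_bigr => j _.
  by rewrite sqrrN.
have lep : \sum_(k < m) \sum_(j < m | j != k) P (Some j) ^+ 2 <= m%:R * p.
  rewrite mulr_natl -[m in leRHS]card_ord -sumr_const; apply: ler_sum => k _.
  rewrite /p [leRHS](bigID (fun j => j != k)) /= lerDl.
  by apply: sumr_ge0 => j _; apply: sqr_ge0.
move: lep; set q := \sum_(k < m) _; have q0 : 0 <= q.
  by do 2![apply: sumr_ge0 => ? _]; apply: sqr_ge0.
move=> lep; rewrite /sqn -/p -/t expr1n expr0n addr0.
have h1 : m%:R * (u ^+ 2 + e') <= m%:R * (G ^+ 2 + 1) by rewrite ler_wpM2l // lerD.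
have h2 : u ^+ 2 * q <= G ^+ 2 * (m%:R * p).
  by apply: ler_pM => //; apply: sqr_ge0.
have g2 : 0 <= G ^+ 2 by apply: sqr_ge0.
have h3 : 0 <= m%:R * (G ^+ 2) * t by apply: mulr_ge0 => //; apply: mulr_ge0.
have h4 : 0 <= m%:R * t by rewrite mulr_ge0.
have h5 : 0 <= m%:R * p by rewrite mulr_ge0.
lra.
Qed.

(** The squares along e_k and e_t alone give the bound, with weights u^2 + e' >= mu^2 and 1. The
    squares involving P are nonnegative and are dropped, whence a constant free of P. *)
Lemma ell_square_ge (u e' mu : R) P z : 0 <= e' -> 0 <= mu <= u ->
  Num.min (mu ^+ 2) 1 * sqn z
  <= ell u e' P (fun i j a b => (a * z i + b * z j) ^+ 2).
Proof.
move=> e0 /andP[mu0 muu].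
have mu2 : mu ^+ 2 <= u ^+ 2 by rewrite ler_sqr ?nnegrE // (le_trans mu0).
rewrite /ell /sqn mulrDr.
have h1 : Num.min (mu ^+ 2) 1 * (\sum_(k < m) z (Some k) ^+ 2) <=
   \sum_(k < m) (u ^+ 2 + e') * (1 * z (Some k) + 0 * z (Some k)) ^+ 2.
  rewrite mulr_sumr; apply: ler_sum => k _; rewrite mul1r mul0r addr0.
  by rewrite ler_wpM2r ?sqr_ge0 // ge_min (le_trans mu2) // lerDl.
have h2 : 0 <= u ^+ 2 * (\sum_(k < m) \sum_(j < m | (j < k)%N)
   (- P (Some j) * z (Some k) + P (Some k) * z (Some j)) ^+ 2).
  rewrite mulr_ge0 ?sqr_ge0 //.
  by do 2![apply: sumr_ge0 => ? _]; apply: sqr_ge0.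
have h3 : 0 <= \sum_(k < m) (- P (Some k) * z None + P None * z (Some k)) ^+ 2.
  by apply: sumr_ge0 => ? _; apply: sqr_ge0.
have h4 : Num.min (mu ^+ 2) 1 * z None ^+ 2 <= (1 * z None + 0 * z None) ^+ 2.
  by rewrite mul1r mul0r addr0 ler_piMl ?sqr_ge0 // ge_min lexx orbT.
lra.
Qed.

(* Here [z] is the steep part of the gradient [P], coming from the logarithmic
   barrier, and [v] the bounded rest. *)
Lemma ell_barrier_lt (u e' mu G A K V : R) P v z E (s : R) :
  0 <= e' <= 1 -> 0 < mu -> mu <= u <= G -> 0 <= A -> 0 <= K ->
  (s = 1 \/ s = -1) ->
  (forall i, P i = v i + z i) -> sqn v <= V -> 1 + 2 * V <= sqn z ->
  3 * (4 * A * (m%:R * (G ^+ 2 + 1) + m%:R + 1) + m%:R * G + m%:R / mu)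
    < K * Num.min (mu ^+ 2) 1 ->
  (forall i j a b, s * E i j a b
     <= 4 * A * (a ^+ 2 + b ^+ 2) - K * (a * z i + b * z j) ^+ 2) ->
  s * (ell u e' P E + m%:R * u * (1 + \sum_(k < m) P (Some k) ^+ 2)
       + m.-1%:R * (P None ^+ 2 / u)) < 0.
Proof.
move=> e01 mu0 /andP[muu uG] A0 K0 s1 Pvz vV zV Kbig leE.
have e0 : 0 <= e' by case/andP: e01.
have u0 : 0 < u := lt_le_trans mu0 muu.
have sqn_ge0 y : 0 <= sqn y.
  by rewrite addr_ge0 ?sqr_ge0 // sumr_ge0 // => k _; apply: sqr_ge0.
have m0 : 0 <= m%:R :> R by [].
have sq2 (x y : R) : (x + y) ^+ 2 <= 2 * x ^+ 2 + 2 * y ^+ 2.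
  by have := sqr_ge0 (x - y); nra.
(* 1 + |P|^2 <= 1 + 2 |v|^2 + 2 |z|^2 <= 3 |z|^2, because |z|^2 >= 1 + 2 V. This is the factor 3 in
   the condition on K. *)
have SP : 1 + sqn P <= 3 * sqn z.
  have : sqn P <= 2 * sqn v + 2 * sqn z.
    rewrite /sqn !mulrDr !mulr_sumr addrACA -big_split /=; apply: lerD.
      by apply: ler_sum => k _; rewrite Pvz.
    by rewrite Pvz.
  lra.
have h1 := ler_ell u e' s P E _ e0 leE.
rewrite ell_combo in h1.
have h2 : ell u e' P (fun _ _ a b => a ^+ 2 + b ^+ 2)
  <= (m%:R * (G ^+ 2 + 1) + m%:R + 1) * (1 + sqn P).
  by apply: ell_norm_le => //; rewrite ltW.
have h3 : Num.min (mu ^+ 2) 1 * sqn z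
  <= ell u e' P (fun i j a b => (a * z i + b * z j) ^+ 2).
  by apply: ell_square_ge => //; rewrite ltW.
have S0 := sqn_ge0 P; have Z0 := sqn_ge0 z.
set p := \sum_(k < m) P (Some k) ^+ 2.
have p0 : 0 <= p by apply: sumr_ge0 => k _; apply: sqr_ge0.
have t0 : 0 <= P None ^+ 2 by apply: sqr_ge0.
have SE : sqn P = p + P None ^+ 2 by [].
have h4 : m%:R * u * (1 + p) <= m%:R * G * (1 + sqn P).
  rewrite -!mulrA ler_wpM2l // ler_pM //; [exact: ltW|exact: addr_ge0|].
  by rewrite lerD2l SE lerDl.
have h5 : m.-1%:R * (P None ^+ 2 / u) <= m%:R / mu * (1 + sqn P).
  rewrite -mulrA; apply: ler_pM => //.
  - by rewrite divr_ge0 // ltW.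
  - by rewrite ler_nat leq_pred.
  rewrite mulrC ler_pM ?invr_ge0 ?(ltW u0) //.
    by rewrite lef_pV2.
  rewrite SE; lra.
have h40 : 0 <= m%:R * u * (1 + p) by rewrite !mulr_ge0 ?(ltW u0) // addr_ge0.
have h50 : 0 <= m.-1%:R * (P None ^+ 2 / u) by rewrite mulr_ge0 // divr_ge0 // ltW.
(* For s = -1 the left side is nonpositive, by [h40] and [h50]. *)
have h6 : s * (m%:R * u * (1 + p) + m.-1%:R * (P None ^+ 2 / u))
  <= (m%:R * G + m%:R / mu) * (1 + sqn P).
  by case: s1 => ->; lra.
have Zp : 0 < sqn z.
  have V0 := le_trans (sqn_ge0 v) vV; lra.
rewrite -addrA mulrDr.
set C1 := m%:R * (G ^+ 2 + 1) + m%:R + 1 in h2 Kbig.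
have C10 : 0 <= C1 by rewrite !addr_ge0 // mulr_ge0 // addr_ge0 // sqr_ge0.
set C2 := m%:R * G + m%:R / mu in h6.
have C20 : 0 <= C2.
  apply: addr_ge0; last by rewrite divr_ge0 // ltW.
  by apply: mulr_ge0 => //; apply: le_trans (ltW u0) uG.
have g1 : 4 * A * ell u e' P (fun _ _ a b => a ^+ 2 + b ^+ 2)
    <= 4 * A * (C1 * (1 + sqn P)) by rewrite ler_wpM2l // mulr_ge0.
have g2 : 4 * A * (C1 * (1 + sqn P)) <= 4 * A * (C1 * (3 * sqn z)).
  by rewrite !ler_wpM2l // mulr_ge0.
have g3 : C2 * (1 + sqn P) <= C2 * (3 * sqn z) by rewrite ler_wpM2l.
have g4 := ler_wpM2l K0 h3.
have g5 : 3 * (4 * A * C1 + C2) * sqn z < K * Num.min (mu ^+ 2) 1 * sqn z.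
  by rewrite ltr_pM2r // /C2 addrA.
rewrite -mulrA in g5.
move: (ell u e' P (fun _ _ a b => a ^+ 2 + b ^+ 2)) g1 h1 => T g1 h1.
move: (ell u e' P (fun i j a b => (a * z i + b * z j) ^+ 2)) g4 h1 => Q g4 h1.
lra.
Qed.

(** Completing the quadratic forms: P_t^2 H_kk, P_k^2 H_tt and the (k, t) cross term give the value
    on P_t e_k - P_k e_t. After [sum_neq_lt], the terms u^2 P_j^2 H_kk and the (j, k) cross terms
    give the values on P_k e_j - P_j e_k. The terms along e_k and e_t remain. *)
Lemma ell_expand (u e' : R) P (H : option 'I_m -> option 'I_m -> R) :
  \sum_(k < m) (u ^+ 2 * (1 + \sum_(j < m | j != k) P (Some j) ^+ 2)
       + P None ^+ 2 + e') * H (Some k) (Some k)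
  + (1 + \sum_(k < m) P (Some k) ^+ 2) * H None None
  - 2 * \sum_(k < m) P (Some k) * P None * H (Some k) None
  - 2 * u ^+ 2 * \sum_(k < m) \sum_(j < m | (j < k)%N)
      P (Some j) * P (Some k) * H (Some j) (Some k)
  = ell u e' P
      (fun i j a b => a ^+ 2 * H i i + 2 * a * b * H j i + b ^+ 2 * H j j).
Proof.
rewrite /ell.
have -> : \sum_(k < m) (u ^+ 2 * (1 + \sum_(j < m | j != k) P (Some j) ^+ 2)
       + P None ^+ 2 + e') * H (Some k) (Some k)
  = \sum_(k < m) (u ^+ 2 + e') * H (Some k) (Some k)
  + u ^+ 2 * (\sum_(k < m) \sum_(j < m | j != k) P (Some j) ^+ 2 * H (Some k) (Some k))
  + P None ^+ 2 * \sum_(k < m) H (Some k) (Some k).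
  rewrite !mulr_sumr -!big_split /=; apply: eq_bigr => k _.
  by rewrite -mulr_suml; ring.
rewrite (sum_neq_lt (fun j k => P (Some j) ^+ 2 * H (Some k) (Some k))).
have -> : \sum_(k < m) (u ^+ 2 + e') * (1 ^+ 2 * H (Some k) (Some k)
    + 2 * 1 * 0 * H (Some k) (Some k) + 0 ^+ 2 * H (Some k) (Some k))
  = \sum_(k < m) (u ^+ 2 + e') * H (Some k) (Some k).
  by apply: eq_bigr => k _; ring.
have -> : \sum_(k < m) \sum_(j < m | (j < k)%N)
   ((- P (Some j)) ^+ 2 * H (Some k) (Some k)
    + 2 * - P (Some j) * P (Some k) * H (Some j) (Some k)
    + P (Some k) ^+ 2 * H (Some j) (Some j))
  = \sum_(k < m) \sum_(j < m | (j < k)%N)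
     (P (Some j) ^+ 2 * H (Some k) (Some k) + P (Some k) ^+ 2 * H (Some j) (Some j))
  - 2 * \sum_(k < m) \sum_(j < m | (j < k)%N)
      P (Some j) * P (Some k) * H (Some j) (Some k).
  rewrite mulr_sumr -sumrB; apply: eq_bigr => k _.
  by rewrite mulr_sumr -sumrB; apply: eq_bigr => j _; ring.
have -> : \sum_(k < m) ((- P (Some k)) ^+ 2 * H None None
    + 2 * - P (Some k) * P None * H (Some k) None + P None ^+ 2 * H (Some k) (Some k))
  = (\sum_(k < m) P (Some k) ^+ 2) * H None None
    - 2 * (\sum_(k < m) P (Some k) * P None * H (Some k) None)
    + P None ^+ 2 * \sum_(k < m) H (Some k) (Some k).
  rewrite mulr_suml !mulr_sumr -sumrB -big_split; apply: eq_bigr => k _ /=; ring.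
ring.
Qed.

End Elliptic.

Lemma Meps_ell (R : realType) (n : nat) (eps : R) (g : pt R n -> R) X :
  Meps eps g X
  = ell (g X) (eps / n.-1%:R) (fun i => pd g i X) (hess2 g X)
    + n.-1%:R * g X * (1 + \sum_(k < n.-1) pd g (Some k) X ^+ 2)
    + n.-2%:R * (pd g None X ^+ 2 / g X).
Proof.
rewrite /Meps; congr (_ + _ + _).
exact: (ell_expand _ _ (fun i => pd g i X) (fun i j => pd2 g i j X)).
Qed.

(** * Euclidean geometry in coordinates *)

Section Geometry.
Context {R : realType} {n : nat}.
Implicit Types (p q w X Y : pt R n) (Omega : set (pt R n)).

(** Indexes points as [axis] and [pd] index directions, so that vectors and gradients can be fed to
    [sqn] alike. *)
Definition coord q (i : option 'I_n.-1) : R := if i is Some k then q.1 0 k else q.2.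

Lemma dotpE p q : dotp p q
  = \sum_(k < n.-1) coord p (Some k) * coord q (Some k) + coord p None * coord q None.
Proof. by []. Qed.

Lemma coord_lin (a b : R) p q i : coord (a *: p + b *: q) i = a * coord p i + b * coord q i.
Proof. by case: i => [k|] /=; rewrite ?mxE. Qed.

Lemma coordB p q i : coord (p - q) i = coord p i - coord q i.
Proof. by case: i => [k|] /=; rewrite ?mxE. Qed.

Lemma coord_axis i j : coord (axis j) i = (i == j)%:R.
Proof. by case: i j => [k|] [l|] //=; rewrite mxE. Qed.

Lemma dotpC p q : dotp p q = dotp q p.
Proof. by rewrite !dotpE; congr (_ + _); [apply: eq_bigr => k _|]; rewrite mulrC. Qed.

Lemma dotp_linr (a b : R) p q w : dotp w (a *: p + b *: q) = a * dotp w p + b * dotp w q.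
Proof.
rewrite !dotpE coord_lin !mulrDr !mulr_sumr addrACA -big_split /=.
by congr (_ + _); [apply: eq_bigr => k _; rewrite /= !mxE|]; ring.
Qed.

Lemma dotp_linl (a b : R) p q w : dotp (a *: p + b *: q) w = a * dotp p w + b * dotp q w.
Proof. by rewrite dotpC dotp_linr !(dotpC w). Qed.

Lemma dotp_axis w i : dotp w (axis i) = coord w i.
Proof.
rewrite dotpE; under eq_bigr do rewrite coord_axis.
rewrite coord_axis; case: i => [k|].
  rewrite (bigD1 k) //= eqxx mulr1 big1 ?mulr0 ?addr0 // => j jk.
  by case: eqP => [[]/eqP|_]; rewrite ?(negPf jk) // mulr0.
by rewrite /= mulr1 big1 ?add0r // => j _; rewrite mulr0.
Qed.

Lemma dotpp_ge0 q : 0 <= dotp q q.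
Proof.
by rewrite addr_ge0 ?sumr_ge0 // => [k _|]; rewrite -expr2 sqr_ge0.
Qed.

Lemma dotpp_eq0 q : dotp q q = 0 -> q = 0.
Proof.
move=> /eqP; rewrite paddr_eq0; last 2 first.
- by apply: sumr_ge0 => k _; rewrite -expr2 sqr_ge0.
- by rewrite -expr2 sqr_ge0.
rewrite psumr_eq0; last by move=> k _; rewrite -expr2 sqr_ge0.
case: q => x t /= /andP[/allP x0]; rewrite mulf_eq0 orbb => /eqP ->.
congr (_, _); apply/rowP => k; rewrite mxE.
by have := x0 k (mem_index_enum _); rewrite /= mulf_eq0 orbb => /eqP.
Qed.

Lemma enorm_ge0 q : 0 <= enorm q. Proof. exact: sqrtr_ge0. Qed.

Lemma sqr_enorm q : enorm q ^+ 2 = dotp q q.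
Proof. by rewrite sqr_sqrtr // dotpp_ge0. Qed.

Lemma sqn_coord q : sqn (coord q) = dotp q q.
Proof. by rewrite /sqn dotpE expr2; congr (_ + _); apply: eq_bigr => k _; rewrite expr2. Qed.

(** Cauchy-Schwarz, from the nonnegative squared length of q - (nu.q) nu. *)
Lemma dotp_le_enorm nu q : dotp nu nu = 1 -> dotp nu q <= enorm q.
Proof.
move=> nu1; have [d0|d0] := leP (dotp nu q) 0.
  exact: le_trans d0 (enorm_ge0 _).
rewrite -ler_sqr ?nnegrE ?enorm_ge0 ?(ltW d0) // sqr_enorm.
have := dotpp_ge0 (1 *: q + (- dotp nu q) *: nu).
rewrite dotp_linr !dotp_linl nu1 (dotpC q nu).
move: (dotp nu q) (dotp q q) => d e; lra.
Qed.

(** The factor 2 pays for the case i = j, where the squared length is (a + b)^2. *)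
Lemma dotp_axes_le i j (a b : R) (e := a *: axis i + b *: axis j : pt R n) :
  dotp e e <= 2 * (a ^+ 2 + b ^+ 2).
Proof.
rewrite /e dotp_linr !dotp_linl !dotp_axis !coord_axis !eqxx (eq_sym j i).
have := sqr_ge0 (a - b); have := sqr_ge0 (a + b).
case: (i == j) => /= h1 h2; lra.
Qed.

Lemma dotp_line w q (h : R) :
  dotp (w + h *: q) (w + h *: q) = dotp w w + 2 * dotp w q * h + dotp q q * h ^+ 2.
Proof.
rewrite -[w in w + _]scale1r dotp_linr !dotp_linl (dotpC q w); ring.
Qed.

Lemma continuous_coord i : continuous (fun q : pt R n => coord q i).
Proof.
case: i => [k|] [x t] /=; last exact: (@cvg_snd _ _ (nbhs x) (nbhs t)).
apply: (@continuous_comp _ _ _ fst (fun y : 'rV[R]_n.-1 => y 0 k)).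
  exact: (@cvg_fst _ _ (nbhs x) (nbhs t)).
exact: coord_continuous.
Qed.

Lemma continuous_coordB p i : continuous (fun q : pt R n => coord (q - p) i).
Proof.
under eq_fun do rewrite coordB.
by move=> q; apply: cvgB; [exact: continuous_coord|exact: cvg_cst].
Qed.

Lemma continuous_sum_coord (F : 'I_n.-1 -> pt R n -> R) :
  (forall k, continuous (F k)) -> continuous (fun q => \sum_(k < n.-1) F k q).
Proof. by move=> cF; apply: continuous_big => //; exact: add_continuous. Qed.

Lemma continuous_dotpB (u : pt R n -> pt R n) p :
  (forall i, continuous (fun q => coord (u q) i)) ->
  continuous (fun q : pt R n => dotp (u q) (q - p)).
Proof.
move=> cu; have c i : continuous (fun q => coord (u q) i * coord (q - p) i).
  move=> q; apply: cvgM; first exact: cu.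
  exact: continuous_coordB.
move=> q; apply: cvgD; last exact: (c None).
by apply: continuous_sum_coord => k; exact: (c (Some k)).
Qed.

Lemma continuous_dotp nu p : continuous (fun q : pt R n => dotp nu (q - p)).
Proof. by apply: continuous_dotpB => i q; exact: cvg_cst. Qed.

Lemma continuous_sqdist p : continuous (fun q : pt R n => dotp (q - p) (q - p)).
Proof. by apply: continuous_dotpB; exact: continuous_coordB. Qed.

Lemma continuous_sqdist_proj (c : 'rV[R]_n.-1) :
  continuous (fun q : pt R n => \sum_(k < n.-1) (q.1 0 k - c 0 k) ^+ 2).
Proof.
apply: continuous_sum_coord => k q.
have cB : {for q, continuous (fun q : pt R n => q.1 0 k - c 0 k)}.
  by apply: cvgB; [exact: (continuous_coord (Some k))|exact: cvg_cst].
exact: (cvgM cB cB).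
Qed.

End Geometry.

(** * Maxima over the closure of the domain *)

Section MaximumPrinciple.
Context {R : realType} {n : nat}.
Variable Omega : set (pt R n).

Lemma bounded_compact_closure : bounded_set Omega -> compact (closure Omega).
Proof.
move=> [M [_ bM]].
pose M1 := `|M| + 1.
have le1 q : Omega q -> `|q| <= M1.
  by apply: (bM M1); rewrite (le_lt_trans (ler_norm M)) // ltrDl.
(* The norm of the product is a sup norm, so its closed ball is a product of two closed balls, each
   of them compact. *)
pose K := [set x : 'rV[R]_n.-1 | `|x| <= M1] `*` [set t : R | `|t| <= M1].
have cK1 (W : normedModType R) : closed [set x : W | `|x| <= M1].
  rewrite [X in closed X](_ : _ = closed_ball_ (@Num.norm R W) 0 M1).
    exact: closed_closed_ball_.
  by apply/seteqP; split=> x; rewrite /closed_ball_ /= sub0r normrN.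
have cK : compact K.
  apply: compact_setX.
    apply: bounded_closed_compact; last exact: (cK1 'rV[R]_n.-1).
    exists M1; split; [exact: num_real|move=> y My x /= xM].
    exact: le_trans xM (ltW My).
  have -> : [set t : R | `|t| <= M1] = `[(- M1), M1]%classic.
    by apply/seteqP; split=> t /=; rewrite in_itv /= ler_norml.
  exact: segment_compact.
apply: (subclosed_compact (@closed_closure _ _) cK).
have KE : K = [set q : pt R n | `|q| <= M1].
  by apply/seteqP; split=> q; rewrite /K /= prod_normE ge_max => /andP.
have clK : closed K by rewrite KE; exact: cK1.
by rewrite [X in _ `<=` X](closure_id K).1 // KE; apply: closure_subset => q /le1.
Qed.

Lemma closure_cases q : closure Omega q -> Omega q \/ bdry Omega q.
Proof.
move=> cq; have [Oq|nOq] := pselect (Omega q); [by left|right].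
by split=> // /interior_subset.
Qed.

(** A positive maximum over the compact closure has to be interior, and each application rules that
    out in its own way through [Fi]. *)
Lemma max_principle (F : pt R n -> R) :
  compact (closure Omega) -> {within closure Omega, continuous F} ->
  (forall q, bdry Omega q -> F q <= 0) ->
  (forall X, Omega X -> 0 < F X -> (forall Y, Omega Y -> F Y <= F X) -> False) ->
  forall q, Omega q -> F q <= 0.
Proof.
move=> cO cF Fb Fi q Oq; have cq := subset_closure Oq.
have [X] := compact_EVT_max (ex_intro _ q cq) cO cF.
rewrite inE => cX maxX.
have le_X Y : Omega Y -> F Y <= F X by move=> /subset_closure cY; apply: maxX; rewrite inE.
rewrite leNgt; apply/negP => Fq.
have FX : 0 < F X := lt_le_trans Fq (le_X _ Oq).
have [OX|/Fb] := closure_cases _ cX; first exact: Fi OX FX le_X.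
by rewrite leNgt FX.
Qed.

Lemma closure_ge0 (h : pt R n -> R) : continuous h ->
  (forall q, Omega q -> 0 <= h q) -> forall q, closure Omega q -> 0 <= h q.
Proof.
move=> ch h0; have cl : closed (h @^-1` [set t | 0 <= t]).
  by apply: preimage_closed; [move=> x _; exact: ch|exact: closed_ge].
move=> q cq; suff : (h @^-1` [set t | 0 <= t]) q by [].
by rewrite ((closure_id _).1 cl); exact: (closure_subset h0).
Qed.

End MaximumPrinciple.

(** The second coefficient is minus the square of the first: after division by K, the concavity of
    the logarithm is K times its squared slope. *)
Lemma jet2_ln (R : realType) (B c : R) : 0 < B ->
  jet2 (fun h => ln (B + c * h)) (c / B) (- (c / B) ^+ 2).
Proof.
move=> B0; pose r := B / (`|c| + 1).
have c1 : 0 < `|c| + 1 by rewrite ltr_wpDl.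
have r0 : 0 < r by rewrite divr_gt0.
have pos (x : R) : `|x| < r -> 0 < B + c * x.
  rewrite ltr_pdivlMr // => xB.
  have : `|c * x| <= `|x| * (`|c| + 1).
    by rewrite normrM mulrC ler_wpM2l // lerDl.
  have := ler_norm (- (c * x)); rewrite normrN; lra.
have Dl (x : R) : is_derive x 1 (fun h : R => B + c * h) c.
  apply: is_derive_eq; rewrite /GRing.scale /=.
  by ring.
have := @jet2_C2 R (fun h => ln (B + c * h)) (fun h => c / (B + c * h))
  (fun h => - (c / (B + c * h)) ^+ 2) r r0.
rewrite mulr0 addr0; apply.
- move=> x /pos px.
  rewrite [c / _]mulrC.
  exact: (@is_derive1_comp R (@ln R) (fun h => B + c * h) x _ _ (is_derive1_ln px) (Dl x)).
- move=> x /pos px; have Dx := Dl x.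
  have px0 : B + c * x != 0 by rewrite gt_eqF.
  have Dv : is_derive x 1 (fun h : R => (B + c * h)^-1) (- (B + c * x) ^- 2 * c).
    split; first by apply: (@derivableV _ _ (fun h : R => B + c * h)).
    by rewrite (@deriveV _ _ (fun h : R => B + c * h)) // derive_val.
  apply: is_derive_eq.
  rewrite /GRing.scale /=; field.
  exact: px0.
- have cV : {for 0, continuous (fun h : R => c / (B + c * h))}.
    apply: cvgM; first exact: cvg_cst.
    apply: cvgV; first by rewrite mulr0 addr0 gt_eqF.
    apply: cvgD; first exact: cvg_cst.
    by apply: cvgM; [exact: cvg_cst|exact: cvg_id].
  apply: cvgN; apply: (cvgM cV cV).
Qed.

Lemma eps_div_01 (R : realType) (n : nat) (eps : R) :
  (2 <= n)%N -> 0 <= eps <= 1 -> 0 <= eps / n.-1%:R <= 1.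
Proof.
case: n => [|[|n]] // _ /andP[e0 e1]; rewrite divr_ge0 //=.
by rewrite ler_pdivrMr // mul1r (le_trans e1) // ler1n.
Qed.

(** * Bounds for a solution from its boundary values *)

Section Comparison.
Context {R : realType} {n : nat}.
Variables (Omega : set (pt R n)) (g : pt R n -> R) (eps : R).
Hypotheses (hn : (2 <= n)%N) (oO : open Omega) (cO : compact (closure Omega)).
Hypotheses (eps01 : 0 <= eps <= 1) (C2g : C2_on Omega g).
Hypotheses (cg : {within closure Omega, continuous g}).
Hypotheses (g0 : forall q, Omega q -> 0 < g q).
Hypotheses (Mg : forall q, Omega q -> Meps eps g q = 0).

Let n1_gt0 : 0 < n.-1%:R :> R.
Proof. by rewrite ltr0n; case: n hn => [|[]]. Qed.

Let e01 := eps_div_01 R n eps hn eps01.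

Lemma lower_bound (mu : R) : (forall q, bdry Omega q -> mu <= g q) ->
  forall q, Omega q -> mu <= g q.
Proof.
move=> gb q Oq; rewrite -subr_le0.
apply: (max_principle Omega (fun q => mu - g q)) => //.
- by move=> x; apply: cvgB; [exact: cvg_cst|exact: cg].
- by move=> {Oq}q /gb; rewrite subr_le0.
move=> X OX _ maxX.
(* The test function is constant: the gradient vanishes at X and the Hessian form is nonnegative, so
   nothing in the equation offsets (n - 1) g > 0. *)
have T i j a b : - 1 * (a * pd g i X + b * pd g j X) = 0 /\
    - 1 * hess2 g X i j a b <= 0.
  apply: (touching Omega g oO C2g (-1) (fun=> - mu)) => //.
    by move=> Y /maxX; lra.
  move=> e e0; exists 1 => // h _; rewrite !(subrr, mul0r, subr0) normr0.
  by rewrite mulr_ge0 ?sqr_ge0 // ltW.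
have P0 i : pd g i X = 0.
  by have [] := T i i 1 0; lra.
have := Mg X OX; rewrite Meps_ell.
have := ler_ell (g X) (eps / n.-1%:R) (-1) (fun i => pd g i X) (hess2 g X)
  (fun _ _ _ _ => 0) (andP e01).1 (fun i j a b => (T i j a b).2).
have -> : ell (g X) (eps / n.-1%:R) (fun i => pd g i X) (fun _ _ _ _ => 0) = 0.
  rewrite /ell !big1 ?mulr0 ?addr0 // => k _; rewrite ?mulr0 //.
  by rewrite big1.
rewrite P0 big1 => [|k _]; last by rewrite P0 expr0n.
rewrite expr0n /= mul0r mulr0 !addr0 mulr1.
have := mulr_gt0 n1_gt0 (g0 X OX).
move: (ell _ _ _ _) (n.-1%:R * g X) => u v; lra.
Qed.

Lemma upper_bound (C rho : R) (c : 'rV[R]_n.-1) :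
  (forall q, closure Omega q -> \sum_(k < n.-1) (q.1 0 k - c 0 k) ^+ 2 <= rho) ->
  (forall q, bdry Omega q -> g q + rho <= C) ->
  1 + 2 * rho <= C ->
  forall q, Omega q -> g q <= C.
Proof.
move=> rho_c gb Crho.
pose Q (q : pt R n) := \sum_(k < n.-1) (q.1 0 k - c 0 k) ^+ 2.
have Q0 q : 0 <= Q q by apply: sumr_ge0 => k _; exact: sqr_ge0.
have QE q : Q q = dotp (q.1 - c, 0) (q.1 - c, 0).
  rewrite /dotp /= mulr0 addr0; apply: eq_bigr => k _.
  by rewrite !mxE expr2.
have cQ : continuous Q by exact: continuous_sqdist_proj.
suff leC q : Omega q -> g q + Q q / 2 - C <= 0.
  by move=> q /leC; have := Q0 q; lra.
move=> Oq; apply: (max_principle Omega (fun q => g q + Q q / 2 - C)) => //.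
- move=> x; apply: cvgB; last exact: cvg_cst.
  apply: cvgD; first exact: cg.
  apply: cvgM; last exact: cvg_cst.
  exact: (continuous_subspaceT cQ).
- move=> {Oq}q bq; have := gb _ bq; have := rho_c q bq.1; rewrite -/(Q q).
  have := Q0 q; lra.
move=> X OX FX maxX.
pose w : pt R n := (X.1 - c, 0).
(* The test function -Q / 2 does not involve t, so its second derivative along e is minus the
   squared length of the x-part [fl e]. *)
pose fl (q : pt R n) : pt R n := (q.1, 0).
have T i j a b : 1 * (a * pd g i X + b * pd g j X)
     = - dotp w (a *: axis i + b *: axis j) /\
    1 * hess2 g X i j a b
     <= - dotp (fl (a *: axis i + b *: axis j)) (fl (a *: axis i + b *: axis j)).
  apply: (touching Omega g oO C2g 1 (fun q => - Q q / 2)) => //.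
    by move=> Y /maxX; lra.
  set e := a *: _ + _.
  have -> : (fun h : R => - Q (X + h *: e) / 2)
      = (fun h => - Q X / 2 + (- dotp w e) * h + (- dotp (fl e) (fl e) / 2) * h ^+ 2).
    apply/funext => h; rewrite !QE -/w.
    have -> : ((X + h *: e).1 - c, 0) = w + h *: fl e.
      by congr (_, _); rewrite /= ?scaler0 ?addr0 // addrAC.
    have -> : dotp w e = dotp w (fl e) by rewrite /dotp /= !mul0r.
    rewrite dotp_line.
    by move: (dotp w w) (dotp w (fl e)) (dotp (fl e) (fl e)) => x y z; field.
  rewrite [X in jet2 _ _ X](_ : _ = 2 * (- dotp (fl e) (fl e) / 2)); first exact: jet2_quad.
  by move: (dotp _ _) => z; field.
have Pi i : pd g i X = - coord w i.
  by have [+ _] := T i i 1 0; rewrite dotp_linr !dotp_axis; lra.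
have := Mg X OX; rewrite Meps_ell.
pose E1 (i j : option 'I_n.-1) (a b : R) : R :=
  - dotp (fl (a *: axis i + b *: axis j)) (fl (a *: axis i + b *: axis j)).
have := ler_ell (g X) (eps / n.-1%:R) 1 (fun i => pd g i X) (hess2 g X)
  E1 (andP e01).1 (fun i j a b => (T i j a b).2).
have E1_le0 i j a b : E1 i j a b <= 0 by rewrite oppr_le0 dotpp_ge0.
have E1k k : E1 (Some k) (Some k) 1 0 = -1.
  rewrite /E1 scale0r addr0 scale1r -[fl _]/(axis (Some k)).
  by rewrite dotp_axis coord_axis eqxx.
(* Each of the n - 1 vectors e_k contributes -1 with weight at least g^2; the other contributions
   are nonpositive. *)
have eE : ell (g X) (eps / n.-1%:R) (fun i => pd g i X) E1 <= - (n.-1%:R * g X ^+ 2).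
  rewrite /ell.
  have h1 : \sum_(k < n.-1) (g X ^+ 2 + eps / n.-1%:R) * E1 (Some k) (Some k) 1 0
      <= - (n.-1%:R * g X ^+ 2).
    under eq_bigr do rewrite E1k mulrN1.
    rewrite sumr_const card_ord mulNrn lerN2 -(mulr_natl (g X ^+ 2 + _)).
    rewrite ler_wpM2l // ?(ltW n1_gt0) //.
    by rewrite lerDl; case/andP: e01.
  have h2 : g X ^+ 2 * (\sum_(k < n.-1) \sum_(j < n.-1 | (j < k)%N)
       E1 (Some k) (Some j) (- pd g (Some j) X) (pd g (Some k) X)) <= 0.
    rewrite mulr_ge0_le0 ?sqr_ge0 //.
    by do 2![apply: sumr_le0 => ? _].
  have h3 : \sum_(k < n.-1) E1 None (Some k) (- pd g (Some k) X) (pd g None X) <= 0.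
    by apply: sumr_le0.
  have := E1_le0 None None 1 0; lra.
have PQ : \sum_(k < n.-1) pd g (Some k) X ^+ 2 = Q X.
  by apply: eq_bigr => k _; rewrite Pi sqrrN /= !mxE.
have Pt : pd g None X = 0 by rewrite Pi /= oppr0.
rewrite PQ Pt expr0n /= mul0r mulr0 addr0 mul1r.
have gX := g0 X OX.
have Qr : Q X <= rho by apply/rho_c/subset_closure.
(* [FX] says g > C - Q / 2, while C >= 1 + 2 rho and Q <= rho. The equation at X forces the
   opposite, g <= 1 + Q. *)
have gQ : 1 + Q X < g X.
  by move: FX Qr Crho (Q0 X) => /=; move: (Q X) (g X) => z y; lra.
have : n.-1%:R * g X * (1 + Q X) < n.-1%:R * g X * g X by rewrite ltr_pM2l // mulr_gt0.
move: eE; rewrite expr2 mulrA.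
move: (ell _ _ _ E1) => u; move: (ell _ _ _ _) => v.
move: (n.-1%:R * g X * (1 + Q X)) (n.-1%:R * g X * g X) => a b; lra.
Qed.

End Comparison.

(** * The barrier at a boundary point *)

Section Barrier.
Context {R : realType} {n : nat}.
Variables (Omega : set (pt R n)) (g : pt R n -> R) (eps : R).
Hypotheses (hn : (2 <= n)%N) (oO : open Omega) (cO : compact (closure Omega)).
Hypotheses (eps01 : 0 <= eps <= 1) (C2g : C2_on Omega g).
Hypotheses (cg : {within closure Omega, continuous g}).
Hypotheses (Mg : forall q, Omega q -> Meps eps g q = 0).

(* The slope of the logarithm is [L] or more wherever the logarithm stays below
   its cap [G]. *)
Lemma barrier_le (p nu : pt R n) (s c0 d0 mu G K L : R)
    (A := G / d0 ^+ 2) (beta := L * K * expR (K * G)) :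
  (s = 1 \/ s = -1) -> 0 < c0 -> 0 < d0 -> 0 < mu -> 0 < G -> 0 < K -> 0 < L ->
  1 + 2 * (2 * A * d0) ^+ 2 <= L ^+ 2 ->
  3 * (4 * A * (n.-1%:R * (G ^+ 2 + 1) + n.-1%:R + 1) + n.-1%:R * G + n.-1%:R / mu)
    < K * Num.min (mu ^+ 2) 1 ->
  (forall q, Omega q -> mu <= g q <= G) ->
  (forall q, closure Omega q -> s * (g q - g p) <= G) ->
  (forall q, bdry Omega q -> enorm (q - p) < d0 -> s * (g q - g p) <= c0) ->
  dotp nu nu = 1 -> (forall q, Omega q -> 0 <= dotp nu (q - p)) ->
  forall q, Omega q -> s * (g q - g p)
    <= c0 + A * dotp (q - p) (q - p) + K^-1 * ln (1 + beta * dotp nu (q - p)).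
Proof.
move=> s1 c00 d00 mu0 G0 K0 L0 LV Kbig gmuG gG gb nu1 nuO q Oq.
have A0 : 0 < A by rewrite divr_gt0 // exprn_gt0.
have beta0 : 0 < beta by rewrite !mulr_gt0 ?expR_gt0.
pose W (q : pt R n) := c0 + A * dotp (q - p) (q - p) + K^-1 * ln (1 + beta * dotp nu (q - p)).
have dcl := closure_ge0 Omega _ (continuous_dotp nu p) nuO.
have arg1 r : closure Omega r -> 1 <= 1 + beta * dotp nu (r - p).
  by move=> /dcl d1; rewrite lerDl mulr_ge0 // ltW.
have ln0 r : closure Omega r -> 0 <= K^-1 * ln (1 + beta * dotp nu (r - p)).
  by move=> /arg1 a1; rewrite mulr_ge0 ?invr_ge0 ?(ltW K0) // ln_ge0.
(* Localization: s (g - g(p)) is at most G, so where it exceeds the barrier both nonnegative terms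
   are below G. As A d0^2 = G, the quadratic one gives |r - p| < d0; the logarithmic one caps the
   argument of the logarithm. *)
have near_p r : closure Omega r -> 0 < s * (g r - g p) - W r ->
    enorm (r - p) < d0 /\ 1 + beta * dotp nu (r - p) < expR (K * G).
  move=> cr FX; have lr := ln0 _ cr; have sG := gG _ cr.
  have D0 := dotpp_ge0 (r - p).
  have AD0 : 0 <= A * dotp (r - p) (r - p) by rewrite mulr_ge0 // ltW.
  rewrite /W in FX; split.
    rewrite -ltr_sqr ?nnegrE ?enorm_ge0 ?(ltW d00) // sqr_enorm.
    have : A * dotp (r - p) (r - p) < A * d0 ^+ 2.
      by rewrite [X in _ < X](_ : _ = G) ?divfK ?gt_eqF ?exprn_gt0 //; lra.
    by rewrite ltr_pM2l.
  have : K^-1 * ln (1 + beta * dotp nu (r - p)) < G by lra.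
  rewrite (mulrC K^-1) ltr_pdivrMr // (mulrC G) => lnlt.
  have a0 := lt_le_trans ltr01 (arg1 _ cr).
  by rewrite -(lnK a0) ltr_expR.
suff : s * (g q - g p) - W q <= 0 by rewrite subr_le0.
apply: (max_principle Omega (fun q => s * (g q - g p) - W q)) => //.
- move=> x; apply: cvgB.
    apply: cvgM; first exact: cvg_cst.
    by apply: cvgB; [exact: cg|exact: cvg_cst].
  move: x; apply: continuous_in_subspaceT => x; rewrite inE => cx.
  have cd := continuous_dotp nu p x; have cD := continuous_sqdist p x.
  have cl : {for x, continuous (@ln R \o (fun q => 1 + beta * dotp nu (q - p)))}.
    apply: continuous_comp; last first.
      by apply: continuous_ln; apply: lt_le_trans (arg1 _ cx).
    apply: cvgD; first exact: cvg_cst.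
    by apply: cvgM; [exact: cvg_cst|exact: cd].
  apply: cvgD; last by apply: cvgM; [exact: cvg_cst|exact: cl].
  apply: cvgD; first exact: cvg_cst.
  by apply: cvgM; [exact: cvg_cst|exact: cD].
- move=> r br; rewrite leNgt; apply/negP => Fr.
  have cr := br.1; have [rd _] := near_p _ cr Fr.
  have := gb _ br rd; have := ln0 _ cr.
  have : 0 <= A * dotp (r - p) (r - p) by rewrite mulr_ge0 ?dotpp_ge0 // ltW.
  rewrite /W in Fr; lra.
move=> X OX FX maxX.
have cX := subset_closure OX.
have [Xd0 argX] := near_p _ cX FX.
set w := X - p; set B := 1 + beta * dotp nu w.
have B0 : 0 < B by apply: lt_le_trans (arg1 _ cX).
(* Slope at X of the logarithmic term in the direction nu; its second derivative in that direction
   is -K psi^2. *)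
pose psi := beta / (K * B).
have T i j (a b : R) (e := a *: axis i + b *: axis j : pt R n) :
    s * (a * pd g i X + b * pd g j X) = 2 * A * dotp w e + psi * dotp nu e /\
    s * hess2 g X i j a b <= 2 * (A * dotp e e) + K^-1 * - (beta * dotp nu e / B) ^+ 2.
  apply: (touching Omega g oO C2g s (fun q => W q + s * g p)) => //.
    by move=> Y /maxX; lra.
  rewrite -/e.
  have -> : (fun h : R => W (X + h *: e) + s * g p)
      = (fun h => ((s * g p + c0 + A * dotp w w) + (2 * A * dotp w e) * h
           + (A * dotp e e) * h ^+ 2) + K^-1 * ln (B + beta * dotp nu e * h)).
    apply/funext => h; rewrite /W.
    have -> : X + h *: e - p = w + h *: e by rewrite /w addrAC.
    have -> : 1 + beta * dotp nu (w + h *: e) = B + beta * dotp nu e * h.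
      by rewrite -[w in LHS]scale1r dotp_linr /B; ring.
    rewrite dotp_line.
    move: (dotp w w) (dotp w e) (dotp e e) (ln _) => x y z l; ring.
  have -> : 2 * A * dotp w e + psi * dotp nu e
      = 2 * A * dotp w e + K^-1 * (beta * dotp nu e / B).
    congr (_ + _); rewrite /psi; move: (dotp nu e) => y; field.
    by rewrite !gt_eqF.
  apply: jet2D; first exact: jet2_quad.
  by apply: jet2Z; apply: jet2_ln.
(* By [argX], B < exp(K G), and beta was defined as L K exp(K G). *)
have psiL : L <= psi.
  rewrite /psi ler_pdivlMr ?mulr_gt0 // /beta mulrA ler_pM2l ?mulr_gt0 //.
  exact: ltW.
pose v i := s * (2 * A * coord w i); pose z i := s * (psi * coord nu i).
have ss : s ^+ 2 = 1 by case: s1 => ->; rewrite ?sqrrN expr1n.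
have sqnZ (k : R) (y : option 'I_n.-1 -> R) : sqn (fun i => s * (k * y i)) = k ^+ 2 * sqn y.
  rewrite /sqn mulrDr mulr_sumr !exprMn ss mul1r; congr (_ + _).
  by apply: eq_bigr => i _; rewrite !exprMn ss mul1r.
(* |w| < d0 bounds |v|^2 by V = (2 A d0)^2, and psi >= L gives |z|^2 >= 1 + 2 V. Since [Meps]
   vanishes at X, the strict inequality reads 0 < 0. *)
have := @ell_barrier_lt R n.-1 (g X) (eps / n.-1%:R) mu G A K ((2 * A * d0) ^+ 2)
  (fun i => pd g i X) v z (hess2 g X) s.
rewrite -Meps_ell Mg // mulr0 ltxx => absurd; apply: notF; apply: absurd => //.
- exact: (eps_div_01 R n).
- exact: gmuG.
- exact: ltW.
- exact: ltW.
- move=> i; rewrite /v /z -mulrDr.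
  have [] := T i i 1 0; rewrite scale1r scale0r addr0 !dotp_axis mul1r mul0r addr0 => <- _.
  by rewrite mulrA -expr2 ss mul1r.
- have A2 : 0 <= 2 * A by apply: mulr_ge0 => //; exact: ltW.
  rewrite /v sqnZ sqn_coord -sqr_enorm -exprMn.
  rewrite ler_sqr ?nnegrE ?(mulr_ge0 A2 (enorm_ge0 _)) ?(mulr_ge0 A2 (ltW d00)) //.
  by apply: ler_wpM2l => //; exact: ltW.
- rewrite /z sqnZ sqn_coord nu1 mulr1; apply: le_trans LV _.
  by rewrite ler_sqr ?nnegrE ?(ltW L0) // (le_trans (ltW L0)).
move=> i j a b; have [_ /le_trans] := T i j a b; apply.
(* Source of the constant 4 A: the quadratic term contributes 2 A |e|^2 <= 4 A (a^2 + b^2). *)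
have := dotp_axes_le i j a b.
set e := a *: _ + _ => ee.
have -> : a * z i + b * z j = s * (psi * dotp nu e).
  by rewrite /z /e dotp_linr !dotp_axis; ring.
have -> : K^-1 * - (beta * dotp nu e / B) ^+ 2 = - (K * (psi * dotp nu e) ^+ 2).
  rewrite /psi; move: (dotp nu e) => y; field.
  by rewrite !gt_eqF.
rewrite (exprMn _ s) ss mul1r.
rewrite lerD2r.
have := ler_wpM2l (ltW A0) ee; move: (dotp e e) => y; lra.
Qed.

End Barrier.

(** * A modulus of continuity uniform over all solutions *)

(** Domain, solution, eps and boundary point are quantified after delta, which encodes the
    uniformity. Convexity enters only as the inward unit vector nu at p. *)
Definition uniform_modulus {R : realType} (n : nat) (eta d0 mu G delta : R) : Prop :=
  forall (Omega : set (pt R n)) (g : pt R n -> R) (eps : R) (p nu : pt R n),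
    open Omega -> compact (closure Omega) -> 0 <= eps <= 1 -> C2_on Omega g ->
    {within closure Omega, continuous g} ->
    (forall q, Omega q -> Meps eps g q = 0) ->
    (forall q, closure Omega q -> mu <= g q <= G) ->
    bdry Omega p ->
    (forall q, bdry Omega q -> enorm (q - p) < d0 -> `|g q - g p| < eta / 3) ->
    dotp nu nu = 1 -> (forall q, Omega q -> 0 <= dotp nu (q - p)) ->
    forall q, Omega q -> enorm (q - p) < delta -> `|g q - g p| < eta.

Lemma exists_modulus (R : realType) (n : nat) (eta d0 mu G : R) :
  (2 <= n)%N -> 0 < eta -> 0 < d0 -> 0 < mu -> 0 < G ->
  exists2 delta : R, 0 < delta & uniform_modulus n eta d0 mu G delta.
Proof.
move=> hn eta0 d00 mu0 G0.
pose A := G / d0 ^+ 2.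
have A0 : 0 < A by rewrite divr_gt0 // exprn_gt0.
pose C := 3 * (4 * A * (n.-1%:R * (G ^+ 2 + 1) + n.-1%:R + 1)
  + n.-1%:R * G + n.-1%:R / mu).
have C0 : 0 <= C.
  have G1 : 0 <= G ^+ 2 + 1 by rewrite addr_ge0 // sqr_ge0.
  have G00 := ltW G0; have A00 := ltW A0.
  rewrite /C mulr_ge0 // !addr_ge0 //.
  - by apply: mulr_ge0; [exact: mulr_ge0|rewrite !addr_ge0 // mulr_ge0].
  - by apply: mulr_ge0.
  - by rewrite divr_ge0 // ltW.
pose lam := Num.min (mu ^+ 2) 1.
have lam0 : 0 < lam by rewrite lt_min exprn_gt0 // ltr01.
(* Gives K lam = C + 1 > C, the condition on K in [barrier_le]. *)
pose K := (C + 1) / lam.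
have K0 : 0 < K by rewrite divr_gt0 // ltr_wpDl.
(* With x = 2 A d0, the condition on L is (1 + 2 x)^2 >= 1 + 2 x^2. *)
pose L := 1 + 2 * (2 * A * d0).
have x0 : 0 < 2 * A * d0 by apply: mulr_gt0 => //; apply: mulr_gt0.
have L0 : 0 < L by rewrite addr_gt0 // mulr_gt0.
have LV : 1 + 2 * (2 * A * d0) ^+ 2 <= L ^+ 2.
  by rewrite /L; move: (2 * A * d0) x0 => x; nra.
have Kbig : C < K * lam by rewrite /K divfK ?gt_eqF // ltrDl.
clearbody L K.
pose beta := L * K * expR (K * G).
have beta0 : 0 < beta by rewrite !mulr_gt0 ?expR_gt0.
(* For |q - p| < 1, using ln(1 + x) <= x, the barrier exceeds eta / 3 by at most M |q - p|. The
   delta below keeps this under eta / 2, and eta / 3 + eta / 2 < eta. *)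
pose M := A + beta / K.
have M0 : 0 < M by rewrite addr_gt0 // divr_gt0.
exists (Num.min 1 (eta / (2 * M))).
  by rewrite lt_min ltr01 divr_gt0 // mulr_gt0.
move=> Omega g eps p nu oO cO eps01 C2g cg Mg gmuG bp gb nu1 nuO q Oq.
rewrite lt_min => /andP[d1 dM].
have key s : (s = 1 \/ s = -1) -> s * (g q - g p)
    <= eta / 3 + A * dotp (q - p) (q - p) + K^-1 * ln (1 + beta * dotp nu (q - p)).
  move=> s1; have leN r : s * (g r - g p) <= `|g r - g p|.
    by case: s1 => ->; rewrite ?mul1r ?mulN1r ?ler_norm // -normrN ler_norm.
  apply: (@barrier_le R n Omega g eps hn oO cO eps01 C2g cg Mg p nu s (eta / 3)
    d0 mu G K L) => //.
  - by rewrite divr_gt0.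
  - by move=> r /subset_closure; exact: gmuG.
  - move=> r cr; have /andP[r1 r2] := gmuG _ cr; have /andP[p1 p2] := gmuG _ bp.1.
    by case: s1 => ->; lra.
  - by move=> r br /(gb _ br) lt3; exact: le_trans (leN r) (ltW lt3).
have d0' := enorm_ge0 (q - p).
have h1 : A * dotp (q - p) (q - p) <= A * enorm (q - p).
  by rewrite -sqr_enorm ler_wpM2l ?(ltW A0) // expr2 ler_piMr // ltW.
have h2 : K^-1 * ln (1 + beta * dotp nu (q - p)) <= beta / K * enorm (q - p).
  have d2 := nuO _ Oq.
  have -> : beta / K * enorm (q - p) = K^-1 * (beta * enorm (q - p)).
    by rewrite mulrA [beta / K]mulrC.
  rewrite ler_wpM2l ?invr_ge0 ?(ltW K0) //.
  apply: (@le_trans _ _ (beta * dotp nu (q - p))).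
    by apply: le_ln1Dx; apply: lt_le_trans (ltrN10 _) _; rewrite mulr_ge0 // ltW.
  by rewrite ler_wpM2l ?(ltW beta0) // dotp_le_enorm.
have h3 : M * enorm (q - p) < eta / 2.
  move: dM; rewrite ltr_pdivlMr ?mulr_gt0 // mulrA => dM.
  move: (enorm (q - p)) dM => e; lra.
have h4 : M * enorm (q - p) = A * enorm (q - p) + beta / K * enorm (q - p) by rewrite mulrDl.
have k1 := key 1 (or_introl erefl); have k2 := key (-1) (or_intror erefl).
rewrite mul1r in k1; rewrite mulN1r in k2.
by rewrite ltr_norml; apply/andP; split; lra.
Qed.

(** * Supporting normals and enclosing disks *)

Lemma inward_normal (R : realType) (n : nat) (Omega : set (pt R n)) p :
  convex_domain Omega -> bdry Omega p ->
  exists2 nu : pt R n, dotp nu nu = 1 & forall q, Omega q -> 0 <= dotp nu (q - p).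
Proof.
move=> cvx /cvx[nu [c [nu0 [hp _] _ side]]].
have nn : 0 < dotp nu nu.
  by rewrite lt_neqAle dotpp_ge0 andbT eq_sym; apply: contra nu0 => /eqP/dotpp_eq0 ->.
have en0 : 0 < enorm nu by rewrite sqrtr_gt0.
(* The sign s selects the side on which Omega lies; the summand 0 nu only gives the vector the shape
   of the bilinearity lemmas. *)
have unit (s : R) : s ^+ 2 = 1 ->
    dotp (s / enorm nu *: nu + 0 *: nu) (s / enorm nu *: nu + 0 *: nu) = 1.
  move=> s2; rewrite dotp_linr !dotp_linl -sqr_enorm !mul0r !addr0.
  rewrite mulrA -expr2 exprMn s2 mul1r -exprMn mulVf ?expr1n // gt_eqF //.
have dist s q : dotp (s / enorm nu *: nu + 0 *: nu) (q - p)
    = s * (dotp nu q - c) / enorm nu.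
  rewrite dotp_linl mul0r addr0 -[q in q - p]scale1r -scaleN1r dotp_linr.
  have -> : dotp nu p = c by exact: hp.
  by rewrite mul1r mulN1r mulrAC.
case: side => side.
- exists (-1 / enorm nu *: nu + 0 *: nu); first by apply: unit; rewrite sqrrN expr1n.
  move=> q /side qc; rewrite dist divr_ge0 ?(ltW en0) //; lra.
- exists (1 / enorm nu *: nu + 0 *: nu); first by apply: unit; rewrite expr1n.
  move=> q /side qc; rewrite dist divr_ge0 ?(ltW en0) //; lra.
Qed.

Lemma compact_ubound (R : realType) (T : topologicalType) (A : set T) (F : T -> R) :
  compact A -> {within A, continuous F} -> exists M, forall q, A q -> F q <= M.
Proof.
move=> cA cF; have [[q Aq]|A0] := pselect (A !=set0); last first.
  by exists 0 => q Aq; exfalso; apply: A0; exists q.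
have [X _ maxX] := compact_EVT_max (ex_intro _ q Aq) cA cF.
by exists (F X) => r Ar; apply: maxX; rewrite inE.
Qed.

(** A nonconstant linear function has no interior maximum. Used with s = 1 and s = -1, it transfers
    the x-range of the boundary to the domain when n = 2. *)
Lemma coord_le_bdry (R : realType) (n : nat) (Omega : set (pt R n)) i (s M : R) :
  open Omega -> compact (closure Omega) -> s != 0 ->
  (forall q, bdry Omega q -> s * coord q i <= M) ->
  forall q, Omega q -> s * coord q i <= M.
Proof.
move=> oO cO s0 leM q Oq; rewrite -subr_le0.
apply: (max_principle Omega (fun q => s * coord q i - M)) => //.
- apply: continuous_subspaceT => x; apply: cvgB; last exact: cvg_cst.
  by apply: cvgM; [exact: cvg_cst|exact: continuous_coord].
- by move=> r /leM; rewrite subr_le0.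
move=> X OX _ maxX.
have /nbhs_ballP [r /= r0 Nr] := open_nbhs_nbhs (conj oO OX).
have S0 : 0 < `|s *: (axis i : pt R n)| + 1 by rewrite ltr_wpDl.
(* Small enough for X + h s e_i to stay in the ball inside Omega, while s x_i grows by h s^2 > 0. *)
pose h := r / 2 / (`|s *: (axis i : pt R n)| + 1).
have h0 : 0 < h by rewrite !divr_gt0.
have OY : Omega (1 *: X + h *: (s *: axis i)).
  apply: Nr; rewrite scale1r -ball_normE /ball_ /= opprD addrA subrr sub0r normrN normrZ.
  rewrite gtr0_norm // /h mulrAC ltr_pdivrMr //.
  have := normr_ge0 (s *: (axis i : pt R n)); move: (`|_ *: _|) => t t0; nra.
have := maxX _ OY; rewrite lerD2r coord_lin -[s *: axis i]addr0 -(scale0r X) coord_lin.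
rewrite coord_axis eqxx /= mul0r addr0 mulr1 mul1r.
have : 0 < h * s ^+ 2 by rewrite mulr_gt0 // lt_neqAle sqr_ge0 andbT eq_sym expf_eq0.
move: (coord X i) => x; lra.
Qed.

(* The slack [+ 1] absorbs that the infimum defining [r_dom] for n >= 3 need not
   be attained. *)
Lemma r_dom_disk (R : realType) (n : nat) (Omega : set (pt R n)) :
  (2 <= n)%N -> Omega !=set0 -> open Omega -> bounded_set Omega ->
  exists c : 'rV[R]_n.-1, forall q, closure Omega q ->
    \sum_(k < n.-1) (q.1 0 k - c 0 k) ^+ 2 <= (r_dom Omega + 1) ^+ 2.
Proof.
move=> hn [q0 Oq0] oO bO.
have cO := bounded_compact_closure Omega bO.
have suffO (c : 'rV[R]_n.-1) (rho : R) :
    (forall q, Omega q -> \sum_(k < n.-1) (q.1 0 k - c 0 k) ^+ 2 <= rho) ->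
    forall q, closure Omega q -> \sum_(k < n.-1) (q.1 0 k - c 0 k) ^+ 2 <= rho.
  move=> leO q cq; rewrite -subr_ge0.
  apply: (closure_ge0 Omega
    (fun q => rho - \sum_(k < n.-1) (q.1 0 k - c 0 k) ^+ 2)) cq.
    by move=> x; apply: cvgB; [exact: cvg_cst|exact: continuous_sqdist_proj].
  by move=> y /leO; rewrite subr_ge0.
case: n hn Omega q0 Oq0 oO bO cO suffO => [|[|[|n]]] // _ Omega q0 Oq0 oO bO cO suffO.
(* For n = 2 the centre is the midpoint of the x-range, whose half-width is [r_dom]. *)
- pose S := [set q.1 0 0 | q in bdry Omega].
  have cx s : {within closure Omega, continuous (fun q => s * coord q (Some (0 : 'I_1)))}.
    apply: continuous_subspaceT => x.
    by apply: cvgM; [exact: cvg_cst|exact: continuous_coord].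
  have [M leM] := compact_ubound R _ _ _ cO (cx 1).
  have [m lem] := compact_ubound R _ _ _ cO (cx (-1)).
  have ubS : has_ubound S.
    by exists M => _ [q bq <-]; have := leM q bq.1; rewrite mul1r.
  have lbS : has_lbound S.
    by exists (- m) => _ [q bq <-]; rewrite lerNl -mulN1r; exact: (lem q bq.1).
  have le_sup q : Omega q -> 1 * coord q (Some (0 : 'I_1)) <= sup S.
    apply: coord_le_bdry => // r br; rewrite mul1r.
    by apply: ub_le_sup => //; exists r.
  have ge_inf q : Omega q -> -1 * coord q (Some (0 : 'I_1)) <= - inf S.
    apply: coord_le_bdry => // r br.
    by rewrite mulN1r lerN2; apply: ge_inf => //; exists r.
  exists (const_mx ((sup S + inf S) / 2)); apply: suffO => q Oq.
  rewrite big_ord_recl big_ord0 addr0 mxE /r_dom -/S.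
  have := le_sup q Oq; have := ge_inf q Oq; rewrite /= mul1r mulN1r lerN2.
  move: (q.1 0 0) (sup S) (inf S) => x u v vx xu.
  rewrite -ler_sqrt ?sqr_ge0 // !sqrtr_sqr ler_norml.
  rewrite ger0_norm; last lra.
  by apply/andP; split; lra.
pose E := [set rho : R | 0 <= rho /\ exists2 c, (fst @` Omega) c &
               forall x, (fst @` Omega) x -> xnorm (x - c) <= rho].
have xnE (x c : 'rV[R]_n.+2) :
    \sum_(k < n.+2) (x - c) 0 k ^+ 2 = \sum_(k < n.+2) (x 0 k - c 0 k) ^+ 2.
  by apply: eq_bigr => k _; rewrite !mxE.
have sum0 (x c : 'rV[R]_n.+2) : 0 <= \sum_(k < n.+2) (x 0 k - c 0 k) ^+ 2.
  by apply: sumr_ge0 => k _; exact: sqr_ge0.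
(* Boundedness makes E nonempty: any point of the projection is a centre for a large radius. Some
   admissible radius then lies below inf E + 1. *)
have hE : has_inf E.
  split; last by exists 0 => rho [].
  have [M leM] := compact_ubound R _ _ _ cO
    (continuous_subspaceT (@continuous_sqdist_proj R n.+3 q0.1)).
  exists (Num.sqrt M); split; first exact: sqrtr_ge0.
  exists q0.1; first by exists q0.
  move=> _ [q Oq <-]; rewrite /xnorm xnE; apply: ler_wsqrtr.
  exact/leM/subset_closure.
have [rho [rho0 [c _ cP]] lt1] := inf_adherent ltr01 hE.
exists c; apply: suffO => q Oq.
have := cP q.1 (ex_intro2 _ _ q Oq erefl); rewrite /xnorm xnE => le_rho.
rewrite -[leLHS]sqr_sqrtr; last exact: sum0.
have r0 : 0 <= inf E + 1 by apply: le_trans rho0 (ltW lt1).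
rewrite ler_sqr ?nnegrE ?sqrtr_ge0 //.
exact: le_trans le_rho (ltW lt1).
Qed.

(** * Choice of delta as a function of the data *)

Theorem theorem4p3 (R : realType) (n : nat) (hn : (2 <= n)%N) :
  exists Delta : forall eta delta0 ming maxg r B1 B2 : R, R,
  forall (Omega : set (pt R n)) (f g : pt R n -> R)
         (eps eta delta0 B1 B2 : R),
    C0_domain Omega ->
    bounded_set Omega ->
    convex_domain Omega ->
    {within bdry Omega, continuous f} ->
    (forall p, bdry Omega p -> 0 < f p) ->
    0 <= eps <= 1 ->
    C2_on Omega g ->
    {within closure Omega, continuous g} ->
    (forall q, Omega q -> 0 < g q) ->
    (forall q, Omega q -> Meps eps g q = 0) ->
    (forall p, bdry Omega p -> g p = f p) ->
    0 < eta ->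
    is_delta0 Omega f eta delta0 ->
    barrier_bounds Omega f eta delta0 B1 B2 ->
    let delta := Delta eta delta0
                   (inf [set g p | p in bdry Omega])
                   (sup [set g p | p in bdry Omega])
                   (r_dom Omega) B1 B2 in
    0 < delta /\
    forall p q, bdry Omega p -> Omega q -> enorm (q - p) < delta ->
      `|g q - g p| < eta.
Proof.
(* The modulus has to be a function fixed before any domain or solution, so the existence result is
   skolemized over all quadruples, with default value 1 where some parameter is not positive. *)
have [D DP] : {D : R * R * R * R -> R & forall x : R * R * R * R,
    let: (eta, d0, mu, G) := x in 0 < D x /\
    (0 < eta -> 0 < d0 -> 0 < mu -> 0 < G -> uniform_modulus n eta d0 mu G (D x))}.
  apply: (choice (P := fun x delta => let: (eta, d0, mu, G) := x in 0 < delta /\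
    (0 < eta -> 0 < d0 -> 0 < mu -> 0 < G -> uniform_modulus n eta d0 mu G delta))).
  move=> [[[eta d0] mu] G] /=.
  have [[[[eta0 d00] mu0] G0]|neg] :=
    pselect ((((0 < eta) /\ (0 < d0)) /\ (0 < mu)) /\ (0 < G)).
    have [delta delta0 deltaP] := exists_modulus R n eta d0 mu G hn eta0 d00 mu0 G0.
    by exists delta.
  by exists 1; split=> // *; exfalso; apply: neg.
(* With rho = (r + 1)^2 from [r_dom_disk], this height bound is at least maxg + rho and at least 1 +
   2 rho, as [upper_bound] requires. *)
exists (fun eta d0 ming maxg r _ _ =>
  D (eta, d0, ming, maxg + 1 + 2 * (r + 1) ^+ 2)).
move=> Omega f g eps eta d0 B1 B2 [ne0 oO _ _] bO cvx _ f0 eps01 C2g cg g0 Mg gf eta0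
  [d00 fd0] _ delta.
rewrite {}/delta; set ming := inf _; set maxg := sup _.
pose G := maxg + 1 + 2 * (r_dom Omega + 1) ^+ 2.
have [delta0 deltaP] := DP (eta, d0, ming, G).
split=> // p q bp Oq qp.
have cO := bounded_compact_closure Omega bO.
have gb r : bdry Omega r -> 0 < g r by move=> br; rewrite gf // f0.
have gcl r : closure Omega r -> 0 < g r.
  by move=> /closure_cases[/g0|/gb].
have [M leM] := compact_ubound R _ _ _ cO cg.
have ubg : has_ubound [set g p | p in bdry Omega] by exists M => _ [r [cr _] <-]; exact: leM.
have lbg : has_lbound [set g p | p in bdry Omega] by exists 0 => _ [r br <-]; rewrite ltW // gb.
have ge_min r : bdry Omega r -> ming <= g r.
  by move=> br; apply: ge_inf => //; exists r.
have le_max r : bdry Omega r -> g r <= maxg.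
  by move=> br; apply: ub_le_sup => //; exists r.
(* Positivity of g on the boundary passes to the infimum because the boundary is compact and the
   minimum is attained. *)
have min0 : 0 < ming.
  have cbd : compact (bdry Omega).
    apply: (subclosed_compact _ cO); last by move=> r [].
    rewrite /bdry setDE; apply: closedI; first exact: closed_closure.
    exact/open_closedC/open_interior.
  have cgb := continuous_subspaceW (fun r (br : bdry Omega r) => br.1) cg.
  have [X] := compact_EVT_min (ex_intro _ p bp) cbd cgb.
  rewrite inE => bX minX; apply: lt_le_trans (gb _ bX) _.
  apply: lb_le_inf; first by exists (g p), p.
  by move=> _ [r br <-]; apply: minX; rewrite inE.
have max0 : 0 < maxg := lt_le_trans (gb _ bp) (le_max _ bp).
have [c cP] := r_dom_disk R n Omega hn ne0 oO bO.
have rr := sqr_ge0 (r_dom Omega + 1).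
have lower := lower_bound Omega g eps hn oO cO eps01 C2g cg g0 Mg ming ge_min.
have upper r : Omega r -> g r <= G.
  apply: (upper_bound Omega g eps hn oO cO eps01 C2g cg g0 Mg G _ c cP).
    by move=> s /le_max; rewrite /G; lra.
  by rewrite /G; lra.
have [nu nu1 nuO] := inward_normal R n Omega p cvx bp.
apply: (deltaP _ _ _ _ Omega g eps p nu) => //.
- by rewrite /G; lra.
- move=> r /closure_cases[Or|br]; first by rewrite lower ?upper.
  by rewrite ge_min //= (le_trans (le_max _ br)) // /G; lra.
- by move=> r br rp; rewrite !gf //; exact: fd0.
Qed.
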